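(* Let $m=\alpha n$, $k=\beta_w n$ with $\alpha,\beta_w$ fixed constants such that $(\alpha,\beta_w)$ is below the fundamental $\ell_1$ characterization, i.e. $\alpha>\alpha_w$ with $\alpha_w=\alpha_w(\beta_w)$ as defined in the context. Let $\sigma>0$, let $r_{socp}>0$ (depending on $n$) and let $r_{socp}^{(sc)}=\lim_{n\to\infty}\frac{r_{socp}}{\sqrt n}$. Let $\mathbf g,\mathbf h$ be $m\times1$ and $n\times1$ vectors of i.i.d. standard normals, and let $\xi_{prim}^{(gen)}(\sigma,\mathbf g,\mathbf h,r_{socp})$, $\nu_{gen}$ and $\|\mathbf w_{gen}\|_2$ be as defined in the context. Set $$C(\theta)=(1-\beta_w)\sqrt{\tfrac2\pi}\,e^{-(\mathrm{erfinv}(\frac{1-\theta}{1-\beta_w}))^2},$$ $$D(\theta)=\frac{1-\beta_w}{\sqrt{2\pi}}\left(\sqrt{2\pi}+2\frac{\sqrt{2(\mathrm{erfinv}(\frac{1-\theta}{1-\beta_w}))^2}}{e^{(\mathrm{erfinv}(\frac{1-\theta}{1-\beta_w}))^2}}-\sqrt{2\pi}\,\frac{1-\theta}{1-\beta_w}\right)+\beta_w,$$ $$A(\theta)=\sigma\frac{\alpha-D(\theta)}{r_{socp}^{(sc)}},\qquad B(\theta)=\sigma\frac{C(\theta)}{r_{socp}^{(sc)}},\qquad F(\theta)=\sqrt2\,\mathrm{erfinv}\Big(\frac{1-\theta}{1-\beta_w}\Big).$$ Let $\hat\theta$ be the solution of $$F(\theta)\,\frac{-(A(\theta)B(\theta)-C(\theta))-\sqrt{(A(\theta)B(\theta)-C(\theta))^2-(B(\theta)^2+\theta)(A(\theta)^2-\alpha+D(\theta))}}{A(\theta)^2-\alpha+D(\theta)}=1.$$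 Then the concentrating points (in the limit $n\to\infty$) of $\nu_{gen}$, $\|\mathbf w_{gen}\|_2$ and $\xi_{prim}^{(gen)}$ are $$E\nu_{gen}=\frac{-(A(\hat\theta)B(\hat\theta)-C(\hat\theta))-\sqrt{(A(\hat\theta)B(\hat\theta)-C(\hat\theta))^2-(B(\hat\theta)^2+\hat\theta)(A(\hat\theta)^2-\alpha+D(\hat\theta))}}{A(\hat\theta)^2-\alpha+D(\hat\theta)},$$ $$E\|\mathbf w_{gen}\|_2=\sigma\sqrt{\frac{(E\nu_{gen})^2D(\hat\theta)-2E\nu_{gen}C(\hat\theta)+\hat\theta}{\alpha(E\nu_{gen})^2-\big((E\nu_{gen})^2D(\hat\theta)-2E\nu_{gen}C(\hat\theta)+\hat\theta\big)}},$$ $$\lim_{n\to\infty}\frac{E\xi_{prim}^{(gen)}(\sigma,\mathbf g,\mathbf h,r_{socp})}{\sqrt n}=\sigma\sqrt{\alpha(E\nu_{gen})^2-\big((E\nu_{gen})^2D(\hat\theta)-2E\nu_{gen}C(\hat\theta)+\hat\theta\big)}-E\nu_{gen}\,r_{socp}^{(sc)}.$$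
   Context: $\mathbf z^{(1)}\in\mathbb R^n$ is the all-ones vector; $\mathrm{erfinv}$ is the inverse of $\mathrm{erf}(x)=\frac{2}{\sqrt\pi}\int_0^x e^{-t^2}dt$. Linear regime: $m=\alpha n<n$, $k=\beta_w n$, constants independent of $n$; $\mathbf g,\mathbf h$ independent. The parameter $\theta$ ranges in $\beta_w\le\theta\le1$. $\mathbf{}$ $$\xi_{prim}^{(gen)}(\sigma,\mathbf g,\mathbf h,r_{socp})=\max_{\nu,\lambda^{(2)}}\ \sigma\sqrt{\|\mathbf g\|_2^2\nu^2-\|\nu\mathbf h+\mathbf z^{(1)}-\lambda^{(2)}\|_2^2}-\nu r_{socp}$$ subject to $\nu\ge0$, $\lambda_i^{(2)}=0$ for $n-k+1\le i\le n$, $0\le\lambda_i^{(2)}\le2$ for $1\le i\le n-k$ (and the expression under the root nonnegative). $\nu_{gen},\lambda^{(gen)}$ denote its solution and $$\|\mathbf w_{gen}\|_2=\sigma\frac{\|\nu_{gen}\mathbf h+\mathbf z^{(1)}-\lambda^{(gen)}\|_2}{\sqrt{\|\mathbf g\|_2^2\nu_{gen}^2-\|\nu_{gen}\mathbf h+\mathbf z^{(1)}-\lambda^{(gen)}\|_2^2}}.$$ In the displayed conclusions $E\nu_{gen}$ and $E\|\mathbf w_{gen}\|_2$ denote the limiting ($n\to\infty$) values of the expectations, around which the random quantities concentrate. Fundamental $\ell_1$ characterization: for given $\beta_w$, $\alpha_w$ is the solution of $$(1-\beta_w)\frac{\sqrt{\frac2\pi}\,e^{-(\mathrm{erfinv}(\frac{1-\alpha_w}{1-\beta_w}))^2}}{\alpha_w}-\sqrt2\,\mathrm{erfinv}\Big(\frac{1-\alpha_w}{1-\beta_w}\Big)=0.$$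 A pair $(\alpha,\beta_w)$ is below the characterization when $\alpha>\alpha_w$.
   Formalization: Since for each n the program is infeasible or unbounded with positive probability, the literal expectations are undefined; the limits are stated as convergence in probability together with convergence of expectations truncated at any level above the modulus of the limit. *)

(* Defs.v *)
From HB Require Import structures.
From mathcomp Require Import all_boot all_order all_algebra.
From mathcomp Require Import all_classical all_reals all_analysis.

Set Implicit Arguments.
Unset Strict Implicit.
Unset Printing Implicit Defensive.

Import Order.TTheory GRing.Theory Num.Theory.
Import numFieldNormedType.Exports.

Local Open Scope classical_set_scope.
Local Open Scope ring_scope.

Section ErrorFunction.
Variable R : realType.

(* The integral over [0, x] is oriented: for x < 0 it is minus the integral
   over [x, 0]. *)
Definition erf (x : R) : R :=
  2 / Num.sqrt pi *
  (if 0 <= x then \int[lebesgue_measure]_(t in `[0, x]) expR (- t ^+ 2)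
   else - \int[lebesgue_measure]_(t in `[x, 0]) expR (- t ^+ 2)).

(* Meaningful for -1 < y < 1 only; the value is 0 where y is not attained. *)
Definition erfinv (y : R) : R := xget 0 [set x | erf x = y].

End ErrorFunction.

Section Scalars.
Variable R : realType.
Implicit Types alpha beta sigma rsc theta : R.

(* [alphaw] solves the fundamental l1 equation.  The range beta < alphaw <= 1
   says that the argument of erfinv lies in [0, 1); at alphaw = beta it is 1,
   where erfinv is infinite. *)
Definition is_alpha_w beta (alphaw : R) : Prop :=
  [/\ beta < alphaw, alphaw <= 1 &
      (1 - beta) *
        (Num.sqrt (2 / pi) * expR (- erfinv ((1 - alphaw) / (1 - beta)) ^+ 2)
         / alphaw)
      - Num.sqrt 2 * erfinv ((1 - alphaw) / (1 - beta)) = 0].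

Definition Cfun beta theta : R :=
  (1 - beta) * Num.sqrt (2 / pi)
  * expR (- erfinv ((1 - theta) / (1 - beta)) ^+ 2).

Definition Dfun beta theta : R :=
  (1 - beta) / Num.sqrt (2 * pi)
  * (Num.sqrt (2 * pi)
     + 2 * (Num.sqrt (2 * erfinv ((1 - theta) / (1 - beta)) ^+ 2)
            / expR (erfinv ((1 - theta) / (1 - beta)) ^+ 2))
     - Num.sqrt (2 * pi) * ((1 - theta) / (1 - beta)))
  + beta.

Definition Afun alpha beta sigma rsc theta : R :=
  sigma * ((alpha - Dfun beta theta) / rsc).

Definition Bfun beta sigma rsc theta : R := sigma * (Cfun beta theta / rsc).

Definition Ffun beta theta : R :=
  Num.sqrt 2 * erfinv ((1 - theta) / (1 - beta)).

Definition nu_den alpha beta sigma rsc theta : R :=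
  Afun alpha beta sigma rsc theta ^+ 2 - alpha + Dfun beta theta.

Definition nu_disc alpha beta sigma rsc theta : R :=
  (Afun alpha beta sigma rsc theta * Bfun beta sigma rsc theta
   - Cfun beta theta) ^+ 2
  - (Bfun beta sigma rsc theta ^+ 2 + theta)
    * nu_den alpha beta sigma rsc theta.

Definition nu_root alpha beta sigma rsc theta : R :=
  (- (Afun alpha beta sigma rsc theta * Bfun beta sigma rsc theta
      - Cfun beta theta)
   - Num.sqrt (nu_disc alpha beta sigma rsc theta))
  / nu_den alpha beta sigma rsc theta.

(* The second line is the well-definedness of the fraction over the reals:
   [Num.sqrt] is 0 on negative numbers and [x / 0] is 0.  At theta = beta the
   argument of erfinv is 1, so that endpoint is excluded as in [is_alpha_w]. *)
Definition is_theta_hat alpha beta sigma rsc theta : Prop :=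
  [/\ beta < theta /\ theta <= 1,
      0 <= nu_disc alpha beta sigma rsc theta
        /\ nu_den alpha beta sigma rsc theta != 0 &
      Ffun beta theta * nu_root alpha beta sigma rsc theta = 1].

End Scalars.

Section Program.
Variable R : realType.

(* Squared Euclidean norm (the library's norm on matrices is the sup norm). *)
Definition sqnorm2 (n : nat) (v : 'cV[R]_n) : R := \sum_(i < n) v i 0 ^+ 2.

Definition norm2 (n : nat) (v : 'cV[R]_n) : R := Num.sqrt (sqnorm2 v).

Section Fixed.
Variables (m n k : nat) (sigma r : R) (g : 'cV[R]_m) (h : 'cV[R]_n).

(* A point is a pair (nu, lambda^(2)). *)
Implicit Type p : R * 'cV[R]_n.

Definition resid p : 'cV[R]_n := p.1 *: h + const_mx 1 - p.2.

Definition radicand p : R := norm2 g ^+ 2 * p.1 ^+ 2 - norm2 (resid p) ^+ 2.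

(* Indices start at 0: the last k coordinates are those with n - k <= i. *)
Definition feasible p : Prop :=
  [/\ 0 <= p.1,
      forall i : 'I_n, (n - k <= i)%N -> p.2 i 0 = 0,
      forall i : 'I_n, (i < n - k)%N -> 0 <= p.2 i 0 <= 2 &
      0 <= radicand p].

Definition objective p : R := sigma * Num.sqrt (radicand p) - p.1 * r.

(* Optimal value: -oo if the program is infeasible, +oo if it is unbounded.
   For Gaussian g and h both happen with positive probability as soon as m and
   k are positive. *)
Definition xi_prim_gen : \bar R :=
  ereal_sup [set (objective p)%:E | p in feasible].

Definition is_solution p : Prop :=
  feasible p /\ forall q, feasible q -> objective q <= objective p.

(* (nu_gen, lambda^(gen)): a solution if there is one, and (0, 0) otherwise. *)
Definition gen_solution : R * 'cV[R]_n := xget (0, 0) is_solution.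

Definition nu_gen : R := gen_solution.1.

Definition norm_w_gen : R :=
  sigma * (norm2 (resid gen_solution) / Num.sqrt (radicand gen_solution)).

End Fixed.
End Program.

Section Randomness.
Context (R : realType) (d : measure_display) (T : measurableType d).
Variable P : probability T R.

Definition mutually_independent (I : finType) (X : I -> {RV P >-> R}) : Prop :=
  forall (J : {set I}) (A : I -> set R), (forall i, measurable (A i)) ->
    P (\bigcap_(i in [set` J]) (X i @^-1` A i))
    = (\prod_(i in J) P (X i @^-1` A i))%E.

Definition standard_normal (X : {RV P >-> R}) : Prop :=
  forall A : set R, measurable A -> distribution P X A = normal_prob 0 1 A.

(* The m + n entries of g and h are i.i.d. standard normal; in particular the
   vectors g and h are independent of each other. *)
Definition iid_gaussian_pair (m n : nat)
    (g : 'I_m -> {RV P >-> R}) (h : 'I_n -> {RV P >-> R}) : Prop :=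
  [/\ forall i, standard_normal (g i),
      forall j, standard_normal (h j) &
      mutually_independent
        (fun s : 'I_m + 'I_n => match s with inl i => g i | inr j => h j end)].

Definition sample (n : nat) (X : 'I_n -> {RV P >-> R}) (w : T) : 'cV[R]_n :=
  \col_i X i w.

Definition truncate (M : R) (x : \bar R) : \bar R :=
  Order.max (- M)%:E (Order.min x M%:E).

(* x is the concentrating point of (X n)_n: X n tends to x in probability (the
   events G n spare any measurability requirement on X n), and the
   expectations of X n, truncated at any level above |x|, tend to x.  The
   truncation is unavoidable: for the program above, with 0 < m and 0 < k, the
   optimal value is infinite with positive probability, and even restricted to
   the event where a solution exists nu_gen and the optimal value fail to be
   integrable. *)
Definition concentrates_at (X : nat -> T -> \bar R) (x : R) : Prop :=
  (forall eps : R, 0 < eps ->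
     exists G : nat -> set T,
       [/\ forall n, measurable (G n),
           forall n w, G n w -> (`|X n w - x%:E| < eps%:E)%E &
           P (G n) @[n --> \oo] --> 1%E])
  /\ (forall M : R, `|x| < M ->
     (\int[P]_w truncate M (X n w))%E @[n --> \oo] --> x%:E).

End Randomness.

(* Main.v *)
(** With c = 1/nu, minimizing over lambda leaves, up to the factor n nu^2, the
    empirical mean of (|h_i| - c)_+^2 over the first n - k coordinates and of
    (h_i + c)^2 over the others.  By the weak law of large numbers this tends
    in probability to a function psi(c), and the optimal value over lambda,
    divided by sqrt n, to
      f(nu) = sigma nu sqrt(alpha - psi(1/nu)) - nu rsc.
    The equation defining theta says that nu = 1/F(theta) is a stationary point
    of f (the other root of the squared stationarity equation is excluded by a
    sign argument), and psi is strongly convex, so nu is a strict local maximum.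
    For fixed g and h the objective is concave, because sqrt(a^2 nu^2 - |x|^2)
    is concave on the Lorentz cone.  A concave function that is larger at nu
    than at nu - eps and nu + eps has all its maximizers in between, and its
    maximum is controlled by these three values.  Hence convergence in
    probability at three points is enough, and no uniform law of large numbers
    is needed. *)
Require Import Defs.
From HB Require Import structures.
From mathcomp Require Import all_boot all_order all_algebra.
From mathcomp Require Import all_classical all_reals all_analysis.
From mathcomp Require Import measurable_realfun ring lra.
Set Implicit Arguments.
Unset Strict Implicit.
Unset Printing Implicit Defensive.

Import Order.TTheory GRing.Theory Num.Theory.
Import numFieldNormedType.Exports.
Local Open Scope classical_set_scope.
Local Open Scope ring_scope.

(** * Gaussian integrals and the error function *)

(** Concavity also settles existence. The program can be infeasible or unbounded, in which case
    [gen_solution] is a default value. On the event where the three comparisons hold, every feasible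
    point at distance at least eps from nu is beaten by a feasible point at nu, so a maximizer over
    the compact interval [nu - eps, nu + eps] solves the whole program. This is also why a strict
    local maximum of f suffices. The assumption [alphaw < alpha] says that alpha exceeds the minimum
    of psi, because the fundamental equation expresses psi' = 0 at F(alphaw). It keeps the limit
    radicand positive at nu, as required by feasibility at the three points and by the division in
    the limit of [norm_w_gen]. *)

Section GaussErf.
Variable R : realType.
Local Notation mu := (@lebesgue_measure R).
Local Notation p := (normal_pdf (0 : R) 1).
Implicit Types x y c : R.

Let gaussE (D : set R) : \int[mu]_(t in D) expR (- t ^+ 2) = \int[mu]_(t in D) gauss_fun t.
Proof. by []. Qed.

Lemma is_derive_cvg (f : R -> R) x df : is_derive x 1 f df -> f t @[t --> x] --> f x.
Proof. by move=> [? _]; exact/differentiable_continuous/derivable1_diffP. Qed.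

Lemma erf_ge0E x : 0 <= x -> erf x = 2 / Num.sqrt pi * \int[mu]_(t in `[0, x]) gauss_fun t.
Proof. by move=> x0; rewrite /erf x0. Qed.

Lemma integrable_gauss_itv (i : interval R) : mu.-integrable [set` i] (EFin \o gauss_fun).
Proof. exact: integrableS integrableT_gauss. Qed.

Lemma is_derive_erf x : 0 < x -> is_derive x 1 (@erf R) (2 / Num.sqrt pi * expR (- x ^+ 2)).
Proof.
move=> x0.
have [d1 d2] := @continuous_FTC1_closed R gauss_fun 0 x (x + 1) (ltac:(lra))
  (integrable_gauss_itv _) x0 (@continuous_gauss_fun R x).
have D : is_derive x 1 (fun x => \int[mu]_(t in `[0, x]) gauss_fun t) (expR (- x ^+ 2)).
  by apply: (DeriveDef d1); rewrite -derive1E; exact: d2.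
have : is_derive x 1 (fun x => 2 / Num.sqrt pi * \int[mu]_(t in `[0, x]) gauss_fun t)
   (2 / Num.sqrt pi * expR (- x ^+ 2)).
  exact: is_deriveZ.
apply: near_eq_is_derive.
near=> z; rewrite erf_ge0E//; apply: ltW; near: z; exact: lt_nbhsr.
Unshelve. all: by end_near. Qed.

Lemma erf0 : erf 0 = 0 :> R.
Proof. by rewrite erf_ge0E// set_itv1 Rintegral_set1 mulr0. Qed.

Lemma erf_cvg0 : erf x @[x --> (0:R)^'+] --> (0:R).
Proof.
have := parameterized_integral_continuous (@ler01 R) (integrable_gauss_itv `[0, 1]).
move/(continuous_within_itvP (_ : R -> R) (@ltr01 R)) => [_ + _].
rewrite /parameterized_integral /= set_itv1 Rintegral_set1 => h.
have : 2 / Num.sqrt pi * \int[mu]_(t in `[0, x]) gauss_fun t @[x --> (0:R)^'+] --> 2 /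
  Num.sqrt pi * (0 : R).
  by apply: cvgMr.
rewrite mulr0; apply: cvg_trans; apply: near_eq_cvg.
by near=> x; rewrite erf_ge0E.
Unshelve. all: by end_near. Qed.

Lemma erf_cvgy : erf x @[x --> +oo] --> (1:R).
Proof.
have h : \int[mu]_(t in `[0, x]) gauss_fun t @[x --> +oo] --> (Num.sqrt pi / 2 : R).
  (* The Gaussian integral is available as the limit pi / 4 of the squared integral, so square roots
     are taken. *)
  have : Num.sqrt ((\int[mu]_(t in `[0, x]) gauss_fun t) ^+ 2) @[x --> +oo]
      --> (Num.sqrt (pi / 4) : R).
    apply: continuous_cvg => //;
      [exact: sqrt_continuous|exact: gauss_integral_proof.cvg_integral0_gauss_sqr].
  rewrite sqrtrM ?pi_ge0// sqrtrV// (_ : 4 = 2 ^+ 2); last first.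
    by rewrite expr2 -natrM.
  rewrite sqrtr_sqr ger0_norm//.
  apply: cvg_trans; apply: near_eq_cvg; near=> r.
  rewrite sqrtr_sqr// ger0_norm//.
  exact: gauss_integral_proof.integral0_gauss_ge0.
have : 2 / Num.sqrt pi * \int[mu]_(t in `[0, x]) gauss_fun t @[x --> +oo] --> 2 / Num.sqrt
  pi * (Num.sqrt pi / 2 : R).
  by apply: cvgMr.
have -> : 2 / Num.sqrt pi * (Num.sqrt pi / 2 : R) = 1.
  have ? : Num.sqrt pi != 0 :> R by rewrite gt_eqF// sqrtr_gt0 pi_gt0.
  by field; rewrite ?[1 != 0]oner_neq0.
apply: cvg_trans; apply: near_eq_cvg.
by near=> x; rewrite erf_ge0E.
Unshelve. all: by end_near. Qed.

(** Since erf is negative on the negative axis, whichever preimage of some y >= 0 [xget] picks is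
    nonnegative. *)
Lemma erf_lt0 x : x < 0 -> erf x < 0.
Proof.
move=> x0; rewrite /erf leNgt x0/= pmulr_rlt0; last first.
  by rewrite divr_gt0// sqrtr_gt0 pi_gt0.
rewrite oppr_lt0 gaussE.
have c : \int[mu]_(t in `[x, 0]) (cst (expR (- x ^+ 2)) t) = expR (- x ^+ 2) * - x.
  rewrite Rintegral_cst//= lebesgue_measure_itv/= lte_fin x0/=.
  by rewrite sub0r.
apply: (@lt_le_trans _ _ (\int[mu]_(t in `[x, 0]) (cst (expR (- x ^+ 2)) t))).
  by rewrite c mulr_gt0 ?expR_gt0// oppr_gt0.
apply: le_Rintegral => //.
- apply: continuous_compact_integrable; first exact: segment_compact.
  by apply: continuous_subspaceT => z; exact: cvg_cst.
- exact: (integrable_gauss_itv `[x, 0]).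
- move=> t /=; rewrite in_itv/= => /andP[xt t0]; rewrite ler_expR lerN2 -[leLHS]sqrrN
    -[leRHS]sqrrN.
  by rewrite ler_sqr ?nnegrE; lra.
Qed.

(** The limit 1 at infinity gives a point where erf exceeds y; the intermediate value theorem then
    provides a preimage for [xget]. *)
Lemma erfinvK y : 0 <= y < 1 -> erf (erfinv y) = y.
Proof.
move=> /andP[y0 y1]; rewrite /erfinv.
suff: exists x, [set x | erf x = y] x by move/(xgetPex 0).
move: erf_cvgy => /cvgrPdist_lt/(_ (1 - y)); rewrite subr_gt0 => /(_ y1) [M [_ hM]].
pose b := Num.max 1 (M + 1).
have b0 : 0 < b by rewrite lt_max ltr01.
have yb : y < erf b.
  have := hM b; rewrite lt_max ltrDl ltr01 orbT => /(_ isT).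
  by move/ltr_normlP => [_]; lra.
have cont : {within `[0, b], continuous (@erf R)}.
  apply/(continuous_within_itvP _ b0); split.
  - move=> z; rewrite in_itv/= => /andP[z0 _]; exact: is_derive_cvg (is_derive_erf z0).
  - by rewrite erf0; exact: erf_cvg0.
  - apply: cvg_at_left_filter.
    exact: is_derive_cvg (is_derive_erf b0).
have [|x _ <-] := @IVT R (@erf R) 0 b y (ltW b0) cont.
  by rewrite erf0 ge_min y0/= le_max (ltW yb) orbT.
by exists x.
Qed.

Lemma erfinv_ge0 y : 0 <= y < 1 -> 0 <= erfinv y.
Proof.
move=> y01; have := erfinvK y01; case: (leP 0 (erfinv y)) => // e0.
by have := erf_lt0 e0; case/andP: y01; lra.
Qed.

(* The probability that |X| <= c for a standard normal X and 0 <= c. *)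
Definition halfnormal_cdf c := erf (c / Num.sqrt 2).

Let sqrt2_gt0 : 0 < Num.sqrt 2 :> R. Proof. by rewrite sqrtr_gt0. Qed.

Lemma normal_pdf01E x : p x = (Num.sqrt (2 * pi))^-1 * expR (- (x ^+ 2 / 2)).
Proof.
rewrite /normal_pdf oner_eq0 /normal_peak /normal_fun.
by rewrite expr1n mul1r mulr_natl subr0 mulNr.
Qed.

Lemma is_derive_normal_pdf01 x : is_derive x 1 p (- x * p x).
Proof.
have -> : p = (fun x => (Num.sqrt (2 * pi))^-1 * expR (- (x ^+ 2 / 2))).
  by apply/funext => z; exact: normal_pdf01E.
apply: is_derive_eq; rewrite /GRing.scale/=.
by set e := expR _; set s := (Num.sqrt _)^-1; field.
Qed.

Lemma is_derive_halfnormal_cdf x : 0 < x -> is_derive x 1 halfnormal_cdf (2 * p x).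
Proof.
move=> x0; rewrite /halfnormal_cdf.
have x20 : 0 < x / Num.sqrt 2 by rewrite divr_gt0.
have d1 := is_derive_erf x20.
have d2 : is_derive x 1 (fun x : R => x / Num.sqrt 2) (Num.sqrt 2)^-1.
  by apply: is_derive_eq; rewrite /GRing.scale/=; ring.
have := @is_derive1_comp R (@erf R) (fun x : R => x / Num.sqrt 2) x _ _ d1 d2.
suff -> : 2 / Num.sqrt pi * expR (- (x / Num.sqrt 2) ^+ 2) * (Num.sqrt 2)^-1 = 2 * p x by [].
rewrite normal_pdf01E expr_div_n sqr_sqrtr// sqrtrM// invfM; ring.
Qed.

Lemma halfnormal_cdf_cvgy : halfnormal_cdf x @[x --> +oo] --> (1 : R).
Proof.
rewrite /halfnormal_cdf; apply: cvg_comp; last exact: erf_cvgy.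
by apply: gt0_cvgMly => //; rewrite invr_gt0.
Qed.

Lemma halfnormal_cdf0 : halfnormal_cdf 0 = 0.
Proof. by rewrite /halfnormal_cdf mul0r erf0. Qed.

Lemma halfnormal_cdf_right_cvg c : 0 <= c -> halfnormal_cdf x @[x --> c^'+] -->
  halfnormal_cdf c.
Proof.
rewrite le_eqVlt => /predU1P[<-|c0].
  rewrite halfnormal_cdf0.
  have : erf (x / Num.sqrt 2) @[x --> (0:R)^'+] --> (0:R).
    apply: cvg_comp; last exact: erf_cvg0.
    move=> A [e /= e0 eA].
    exists (e * Num.sqrt 2) => /=; first by rewrite mulr_gt0.
    move=> z /=; rewrite sub0r normrN => ze z0; apply: eA => /=; last by rewrite divr_gt0.
    by rewrite sub0r normrN normrM [X in _ * X]gtr0_norm ?invr_gt0// ltr_pdivrMr.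
  by [].
apply: cvg_at_right_filter.
exact: is_derive_cvg (is_derive_halfnormal_cdf c0).
Qed.

Lemma normal_pdf01_ge0 x : 0 <= p x. Proof. exact: normal_pdf_ge0. Qed.

Lemma mul_normal_pdf01_cvgy : x * p x @[x --> +oo] --> (0:R).
Proof.
have h : 2 * (Num.sqrt (2 * pi))^-1 * x^-1 @[x --> +oo] --> (0:R).
  rewrite -[X in _ --> X](mulr0 (2 * (Num.sqrt (2 * pi))^-1 : R)).
  apply: cvgMr; apply/gtr0_cvgV0; last exact: cvg_id.
  by near=> x.
apply: (squeeze_cvgr _ (cvg_cst 0) h).
near=> x; have x0 : 0 < x by [].
rewrite mulr_ge0 ?normal_pdf01_ge0 ?(ltW x0)//= normal_pdf01E.
have g0 : 0 < (Num.sqrt (2 * pi))^-1 :> R by rewrite invr_gt0 sqrtr_gt0 mulr_gt0// pi_gt0.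
rewrite [leLHS](_ : _ = (Num.sqrt (2 * pi))^-1 * (x * expR (- (x ^+ 2 / 2)))); last by ring.
rewrite [leRHS](_ : _ = (Num.sqrt (2 * pi))^-1 * (2 * x^-1)); last by ring.
rewrite ler_pM2l// expRN ler_pdivrMr ?expR_gt0//.
have e := expR_ge1Dx (x ^+ 2 / 2).
rewrite -[leLHS](_ : 2 / x * (x ^+ 2 / 2) = x); last by field; rewrite gt_eqF.
rewrite ler_pM2l ?divr_gt0//; lra.
Unshelve. all: by end_near. Qed.

Lemma normal_pdf01_cvgy : p x @[x --> +oo] --> (0:R).
Proof.
apply: (squeeze_cvgr _ (cvg_cst 0) mul_normal_pdf01_cvgy).
near=> x; rewrite normal_pdf01_ge0/= ler_peMl ?normal_pdf01_ge0//.
Unshelve. all: by end_near. Qed.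

(** An antiderivative of (a x + b)^2 p(x) on x > 0, obtained by parts from p' = - x p; the half in
    front is due to the derivative 2 p of [halfnormal_cdf]. *)
Let H a b x := (a ^+ 2 + b ^+ 2) / 2 * halfnormal_cdf x - (a ^+ 2 * x + 2 * a * b) * p x.

Let is_derive_H a b x : 0 < x -> is_derive x 1 (H a b) ((a * x + b) ^+ 2 * p x).
Proof.
move=> x0; have d1 := is_derive_halfnormal_cdf x0; have d2 := is_derive_normal_pdf01 x.
by rewrite /H; apply: is_derive_eq; rewrite /GRing.scale/=; field.
Qed.

Lemma normal_pdf01_cts : continuous p.
Proof. by apply: continuous_normal_pdf; rewrite oner_neq0. Qed.

(** General a and b, so that one formula covers (x + c)^2, its reflection (- x + c)^2, (x - c)^2 and
    the constant 1. *)
Lemma integral_normal_tail_quad a b c : 0 <= c ->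
  (\int[mu]_(x in `[c, +oo[) ((a * x + b) ^+ 2 * p x)%:E =
   ((a ^+ 2 + b ^+ 2) / 2 * (1 - halfnormal_cdf c) + (a ^+ 2 * c + 2 * a * b) * p c)%:E)%E.
Proof.
move=> c0.
rewrite (@ge0_continuous_FTC2y _ _ (H a b) c ((a ^+ 2 + b ^+ 2) / 2)).
- by rewrite /H -EFinB; congr EFin; ring.
- by move=> x _; rewrite mulr_ge0 ?sqr_ge0 ?normal_pdf01_ge0.
- apply: continuous_subspaceT => z.
  apply: cvgM; last exact: normal_pdf01_cts.
  apply: (@is_derive_cvg (fun x : R => (a * x + b) ^+ 2) z (2 * a * (a * z + b))).
  by apply: is_derive_eq; rewrite /GRing.scale/=; ring.
- have e : (a ^+ 2 + b ^+ 2) / 2 = (a ^+ 2 + b ^+ 2) / 2 * 1 - (a ^+ 2 * 0 + 2 * a * b * 0)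
    by ring.
  rewrite [X in _ --> X]e /H.
  apply: cvgB; first by apply: cvgMr; exact: halfnormal_cdf_cvgy.
  under eq_fun do rewrite mulrDl -mulrA.
  by apply: cvgD; apply: cvgMr; [exact: mul_normal_pdf01_cvgy|exact: normal_pdf01_cvgy].
- by move=> x cx; have [] := is_derive_H a b (le_lt_trans c0 cx).
- apply: cvgB; first by apply: cvgMr; exact: halfnormal_cdf_right_cvg.
  apply: cvg_at_right_filter; apply: cvgM; last exact: normal_pdf01_cts.
  apply: cvgD; last exact: cvg_cst.
  by apply: cvgMr; exact: cvg_id.
- move=> x; rewrite in_itv/= andbT => cx; rewrite derive1E.
  by have [_ ->] := is_derive_H a b (le_lt_trans c0 cx).
Qed.

(** For a = 0 and b = 1 the tail formula gives (1 - [halfnormal_cdf c]) / 2 as the integral of a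
    nonnegative density. *)
Lemma halfnormal_cdf_le1 c : 0 <= c -> halfnormal_cdf c <= 1.
Proof.
move=> c0; have := integral_normal_tail_quad 0 1 c0.
have : (0 <= \int[mu]_(x in `[c, +oo[) ((0 * x + 1) ^+ 2 * p x)%:E)%E.
  by apply: integral_ge0 => x _; rewrite lee_fin mulr_ge0 ?sqr_ge0 ?normal_pdf01_ge0.
by move=> + h; rewrite h lee_fin; lra.
Qed.

(** The change of variables is available for the Radon-Nikodym derivative, which equals p almost
    everywhere because both have the same integral over every measurable set. *)
Lemma integral_normal_prob01 (f : R -> \bar R) :
  measurable_fun [set: R] f -> (forall x, (0 <= f x)%E) ->
  (\int[normal_prob 0 1]_x f x = \int[mu]_x (f x * (p x)%:E))%E.
Proof.
move=> mf f0.
have dom := @normal_prob_dominates R 0 1.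
rewrite -(@Radon_Nikodym_SigmaFinite.change_of_variables _ _ _ (normal_prob 0 1) mu dom)//.
apply: ae_eq_integral => //.
- apply: emeasurable_funM => //; apply: (measurable_int mu).
  exact: Radon_Nikodym_SigmaFinite.f_integrable.
- apply: emeasurable_funM => //=; apply/measurableT_comp => //=.
  exact: measurable_normal_pdf.
- apply: ae_eqe_mul2l => /=.
  apply: integral_ae_eq => //=.
  + exact: Radon_Nikodym_SigmaFinite.f_integrable.
  + by apply/measurableT_comp => //; exact: measurable_normal_pdf.
  + by move=> E _ mE; rewrite -Radon_Nikodym_SigmaFinite.f_integral.
Qed.

(** The density is even, so the negative half-line folds onto the positive one, where the tail
    formula applies. *)
Lemma integral_normal_prob01_sym (f : R -> R) :
  (forall x, 0 <= f x) -> continuous f ->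
  (\int[normal_prob 0 1]_x (f x)%:E =
   \int[mu]_(x in `[0%R, +oo[) (f x * p x)%:E +
   \int[mu]_(x in `[0%R, +oo[) (f (- x) * p x)%:E)%E.
Proof.
move=> f0 cf.
have mf : measurable_fun [set: R] f by exact: continuous_measurable_fun.
have cfp : continuous (fun x => f x * p x).
  by move=> x; apply: cvgM; [exact: cf|exact: normal_pdf01_cts].
have mfp : measurable_fun [set: R] (fun x => f x * p x) by exact: continuous_measurable_fun.
have fp0 x : 0 <= f x * p x by rewrite mulr_ge0 ?normal_pdf01_ge0.
rewrite integral_normal_prob01//; last exact/measurable_EFinP.
under eq_integral do rewrite -EFinM.
have mposnums : measurable [set x : R | 0 <= x] by rewrite -set_itvcy.
rewrite -(setUv [set x : R | 0 <= x]) ge0_integral_setU//= ; last 4 first.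
  exact: measurableC.
  by apply/measurable_EFinP; rewrite setUv.
  by move=> x _; rewrite lee_fin.
  exact/disj_setPCl.
congr +%E; first by rewrite set_itvcy.
rewrite -set_itvcy// setCitvr.
rewrite integral_itv_bndo_bndc; last exact/measurable_EFinP/measurable_funTS.
rewrite -{1}oppr0 ge0_integration_by_substitutionNy//.
- apply: eq_integral => /= x _.
  by rewrite !normal_pdf01E sqrrN.
- exact: continuous_subspaceT.
Qed.

Lemma normal_prob01_shift_sqr c :
  (\int[normal_prob 0 1]_x ((x + c) ^+ 2)%:E = (1 + c ^+ 2)%:E)%E.
Proof.
rewrite integral_normal_prob01_sym.
- under eq_integral do rewrite -[X in X + c]mul1r.
  rewrite integral_normal_tail_quad//.
  under eq_integral do rewrite -[X in X + c]mulN1r.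
  rewrite integral_normal_tail_quad// -EFinD halfnormal_cdf0; congr EFin.
  by set q := p 0; field.
- by move=> x; exact: sqr_ge0.
- move=> z; apply: (@is_derive_cvg (fun x : R => (x + c) ^+ 2) z (2 * (z + c))).
  by apply: is_derive_eq; rewrite /GRing.scale/=; ring.
Qed.

(** The mean squared distance from a standard normal variable to [-c, c], for 0 <= c. *)
Definition gauss_excess c := (1 + c ^+ 2) * (1 - halfnormal_cdf c) - 2 * c * p c.

Lemma normal_prob01_excess_sqr c : 0 <= c ->
  (\int[normal_prob 0 1]_x (Num.max (`|x| - c) 0 ^+ 2)%:E = (gauss_excess c)%:E)%E.
Proof.
move=> c0.
have half (f : R -> R) : (forall x, 0 <= x -> f x = Num.max (x - c) 0 ^+ 2) ->
    (\int[mu]_(x in `[0%R, +oo[) (f x * p x)%:E = (gauss_excess c / 2)%:E)%E.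
  move=> fE.
  transitivity (\int[mu]_(x in `[c, +oo[) ((1 * x + - c) ^+ 2 * p x)%:E)%E.
    rewrite [LHS]integral_mkcond [RHS]integral_mkcond; apply: eq_integral => x _.
    rewrite !patchE !mem_setE/= !in_itv/= !andbT.
    case: (leP c x) => cx.
      by rewrite (le_trans c0 cx) fE ?(le_trans c0 cx)// max_l ?subr_ge0// mul1r.
    case: (leP 0 x) => x0 //.
    by rewrite fE// max_r ?subr_le0 ?ltW// expr0n/= mul0r.
  rewrite integral_normal_tail_quad// /gauss_excess; congr EFin.
  by set q := p c; set F := halfnormal_cdf c; field.
rewrite integral_normal_prob01_sym.
- rewrite (half (fun x => Num.max (`|x| - c) 0 ^+ 2)); last by move=> x x0; rewrite ger0_norm.
  rewrite (half (fun x => Num.max (`|- x| - c) 0 ^+ 2)); last by move=> x x0;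
    rewrite normrN ger0_norm.
  by rewrite -EFinD -splitr.
- by move=> x; exact: sqr_ge0.
- move=> x; apply: (@continuous_comp _ _ _ (fun x : R => Num.max (`|x| - c) 0) (fun y =>
    y ^+ 2)).
    apply: continuous_max; last exact: cvg_cst.
    by apply: cvgB; [exact: norm_continuous|exact: cvg_cst].
  exact: exprn_continuous.
Qed.

(** With t = 2 x^2 + 2 c^2, the bound t <= 16 exp(t / 16) gives t^2 <= 256 exp(c^2 / 4) exp(x^2 /
    4), and exp(x^2 / 4) p(x) is a multiple of the normal density of variance 2. This integrand
    dominates the squares of all summands to which the law of large numbers is applied. *)
Lemma normal_prob01_fourth_lty c :
  exists K : R, (\int[normal_prob 0 1]_x ((2 * x ^+ 2 + 2 * c ^+ 2) ^+ 2)%:E <= K%:E)%E.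
Proof.
have s20 : Num.sqrt 2 != 0 :> R by rewrite gt_eqF.
pose K := 256 * expR (c ^+ 2 / 4) * (Num.sqrt (2 * pi))^-1 / normal_peak (Num.sqrt 2).
exists K.
have K0 : 0 <= K.
  rewrite /K !mulr_ge0 ?expR_ge0 ?invr_ge0 ?sqrtr_ge0// normal_peak_ge0//.
have mq : measurable_fun [set: R] (fun x : R => (2 * x ^+ 2 + 2 * c ^+ 2) ^+ 2).
  apply: measurable_funX; apply: measurable_funD => //; apply: measurable_funM => //.
rewrite integral_normal_prob01; last 2 first.
- exact/measurable_EFinP.
- by move=> x; rewrite lee_fin sqr_ge0.
under eq_integral do rewrite -EFinM.
apply: (@le_trans _ _ (\int[mu]_x (K%:E * (normal_pdf 0 (Num.sqrt 2) x)%:E))%E).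
  apply: ge0_le_integral => //.
  - by move=> x _; rewrite lee_fin mulr_ge0 ?sqr_ge0 ?normal_pdf01_ge0.
  - apply/measurable_EFinP; apply: measurable_funM => //; exact: measurable_normal_pdf.
  - by apply/measurable_EFinP; apply: measurable_funM => //; exact: measurable_normal_pdf.
  - move=> x _; rewrite -EFinM lee_fin normal_pdf01E.
    have -> : normal_pdf 0 (Num.sqrt 2) x = normal_peak (Num.sqrt 2) * (expR (- (x ^+ 2 /
      2)) * expR (x ^+ 2 / 4)).
      rewrite /normal_pdf (negbTE s20) /normal_fun subr0 sqr_sqrtr// -expRD.
      by congr (_ * expR _); rewrite -mulr_natr; field.
    have pk0 : normal_peak (Num.sqrt 2) != 0 :> R by rewrite gt_eqF// normal_peak_gt0.
    rewrite /K [leRHS](_ : _ = 256 * (expR (c ^+ 2 / 4) * expR (x ^+ 2 / 4)) * ((Num.sqrt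
      (2 * pi))^-1 * expR (- (x ^+ 2 / 2)))); last first.
      set z := (Num.sqrt (2 * pi))^-1; set e1 := expR (c ^+ 2 / 4);
        set e2 := expR (x ^+ 2 / 4); set e3 := expR (- _).
      by set w := normal_peak _ in pk0 *; field.
    rewrite ler_wpM2r ?mulr_ge0 ?invr_ge0 ?sqrtr_ge0 ?expR_ge0//.
    rewrite -expRD.
    set t := 2 * x ^+ 2 + 2 * c ^+ 2.
    have t0 : 0 <= t by rewrite addr_ge0// mulr_ge0// sqr_ge0.
    have -> : c ^+ 2 / 4 + x ^+ 2 / 4 = t / 16 + t / 16 by rewrite /t; field.
    rewrite expRD -expr2.
    have -> : 256 * expR (t / 16) ^+ 2 = (16 * expR (t / 16)) ^+ 2 by ring.
    rewrite ler_sqr ?nnegrE ?mulr_ge0 ?expR_ge0//.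
    by have := expR_ge1Dx (t / 16); lra.
rewrite ge0_integralZl//; last 2 first.
- by apply/measurable_EFinP; exact: measurable_normal_pdf.
- by move=> x _; rewrite lee_fin normal_pdf_ge0.
by rewrite integral_normal_pdf mule1.
Qed.

End GaussErf.

(** * Convergence in probability *)

Section Whp.
Context (R : realType) (d : measure_display) (T : measurableType d).
Variable P : probability T R.

(** The shape of the first clause of [concentrates_at]: measurable inner events stand in for Q,
    since [gen_solution] is picked by choice and events about it need not be measurable. *)
Definition whp (Q : nat -> T -> Prop) : Prop :=
  exists G : nat -> set T, [/\ forall n, measurable (G n),
    forall n w, G n w -> Q n w & P (G n) @[n --> \oo] --> 1%E].

Lemma whp_near (Q : nat -> T -> Prop) :
  (\forall n \near \oo, forall w, Q n w) -> whp Q.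
Proof.
move=> Qn; exists (fun n => if `[< forall w, Q n w >] then setT else set0); split.
- by move=> n; case: ifP.
- by move=> n w; case: ifPn => // /asboolP.
- apply: cvg_near_cst; near=> n.
  have -> : `[< forall w, Q n w >] by apply/asboolP; near: n.
  by rewrite probability_setT.
Unshelve. all: by end_near. Qed.

Lemma whpI (Q1 Q2 : nat -> T -> Prop) :
  whp Q1 -> whp Q2 -> whp (fun n w => Q1 n w /\ Q2 n w).
Proof.
move=> [A [mA AQ PA]] [B [mB BQ PB]]; exists (fun n => A n `&` B n); split.
- by move=> n; exact: measurableI.
- by move=> n w [/AQ ? /BQ ?].
have low n : (P (A n) + P (B n) - 1 <= P (A n `&` B n))%E.
  rewrite leeBlDr//.
  have -> : P (A n) = (P (A n `&` B n) + P (A n `\` B n))%E.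
    rewrite -measureU//; last 3 first.
    - exact: measurableI.
    - exact: measurableD.
    - by rewrite setDE setIACA setICr setI0.
    by rewrite setUIDK.
  rewrite -addeA leeD2l//.
  rewrite -(probability_setT P) -(setUv (B n)) measureU//; last 2 first.
  - exact: measurableC.
  - by rewrite setICr.
  rewrite addeC leeD2l// le_measure ?inE//.
  - exact: measurableD.
  - exact: measurableC.
apply: (@squeeze_cvge _ _ _ _ (fun n => P (A n) + P (B n) - 1)%E _ (cst 1%E)).
- by apply: nearW => n; rewrite low/= probability_le1//; exact: measurableI.
- have : ((P (A n) + P (B n) - 1)%E @[n --> \oo] --> (1 + 1 - 1)%E).
    by apply: cvgeB => //; [apply: cvgeD|exact: cvg_cst].
  by rewrite addeK.
- exact: cvg_cst.
Qed.

Lemma whp_mono (Q1 Q2 : nat -> T -> Prop) :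
  whp Q1 -> (\forall n \near \oo, forall w, Q1 n w -> Q2 n w) -> whp Q2.
Proof.
move=> h1 /whp_near h2; have [G [? GQ ?]] := whpI h1 h2.
by exists G; split => // n w /GQ[? ]; apply.
Qed.

(** With neighbourhoods instead of distances, the continuous mapping theorem is a composition of
    preimages and pairs are handled by the product topology. *)
Definition cvg_prob {U : topologicalType} (X : nat -> T -> U) (x : U) : Prop :=
  forall A, nbhs x A -> whp (fun n w => A (X n w)).

Lemma cvg_prob_det {U : topologicalType} (u : nat -> U) (x : U) :
  u n @[n --> \oo] --> x -> cvg_prob (fun n _ => u n) x.
Proof. by move=> h A /h ?; apply: whp_near; near=> n => _; near: n.
Unshelve. all: by end_near. Qed.

Lemma cvg_prob_cts {U V : topologicalType} (f : U -> V) (X : nat -> T -> U) x :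
  {for x, continuous f} -> cvg_prob X x -> cvg_prob (fun n w => f (X n w)) (f x).
Proof. by move=> cf Xx A /cf /Xx. Qed.

Lemma cvg_prob_pair {U V : topologicalType} (X : nat -> T -> U) (Y : nat -> T -> V) x y :
  cvg_prob X x -> cvg_prob Y y -> cvg_prob (fun n w => (X n w, Y n w)) (x, y).
Proof.
move=> Xx Yy A [[B1 B2] /= [/Xx h1 /Yy h2] BA].
apply: whp_mono (whpI h1 h2) _; apply: nearW => n w [? ?]; exact: BA.
Qed.

Lemma cvg_prob_cts2 {U V W : topologicalType} (f : U * V -> W)
   (X : nat -> T -> U) (Y : nat -> T -> V) x y :
  {for (x, y), continuous f} -> cvg_prob X x -> cvg_prob Y y ->
  cvg_prob (fun n w => f (X n w, Y n w)) (f (x, y)).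
Proof. by move=> cf hX hY; apply: cvg_prob_cts cf _; exact: cvg_prob_pair. Qed.

Lemma cvg_prob_eq {U : topologicalType} (X Y : nat -> T -> U) x :
  cvg_prob X x -> whp (fun n w => Y n w = X n w) -> cvg_prob Y x.
Proof.
move=> hX hE A /hX hA; apply: whp_mono (whpI hA hE) _.
by apply: nearW => n w [? ->].
Qed.

Lemma cvg_probP (X : nat -> T -> R) x :
  (forall e, 0 < e -> whp (fun n w => `|X n w - x| < e)) -> cvg_prob X x.
Proof.
move=> h A [e /= e0 eA]; apply: whp_mono (h _ e0) _; apply: nearW => n w /= ?.
by apply: eA => /=; rewrite distrC.
Qed.

Lemma cvg_prob_dist (X : nat -> T -> R) x e : cvg_prob X x -> 0 < e ->
  whp (fun n w => `|X n w - x| < e).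
Proof.
move=> h e0; apply: (h [set y | `|y - x| < e]); exists e => //= y /=.
by rewrite distrC.
Qed.

Lemma cvg_prob_gt (X : nat -> T -> R) x a : cvg_prob X x -> a < x ->
  whp (fun n w => a < X n w).
Proof. by move=> h ax; apply: (h [set y | a < y]); exact: lt_nbhsr. Qed.

(* No measurability is required: the integral is a difference of suprema of
   integrals of simple functions. *)
Lemma le_integral_any (f g : T -> \bar R) : (forall w, (f w <= g w)%E) ->
  (\int[P]_w f w <= \int[P]_w g w)%E.
Proof.
move=> fg; rewrite /integral !patch_setT.
apply: leeB; apply: le_ereal_sup => _ [k /= ku <-]; exists k => // w;
  apply: le_trans (ku w) _.
- by rewrite !funeposE ge_max !le_max lexx !orbT fg.
- by rewrite !funenegE ge_max !le_max lexx !orbT leeN2 fg.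
Qed.

(** The truncation is within e of x on G n and within [- M, M] elsewhere. Its integral is therefore
    squeezed between those of two functions that are constant on G n and on its complement, whose
    probability tends to 0. *)
Lemma concentrates_at_whp (X : nat -> T -> \bar R) (x : R) :
  (forall e : R, 0 < e -> whp (fun n w => (`|X n w - x%:E| < e%:E)%E)) ->
  concentrates_at P X x.
Proof.
move=> h; split => [e /h//|M xM].
have M0 : 0 < M by apply: le_lt_trans xM.
have mx : - M < x < M by move: xM; rewrite ltr_norml.
(* The condition on e keeps [x - e, x + e] inside [- M, M], where truncation is the identity; the
   second e pays for the complement of G n. *)
suff bound (e : R) : 0 < e -> e < M - `|x| -> \forall n \near \oo,
   ((x - 2 * e)%:E <= \int[P]_w truncate M (X n w) <= (x + 2 * e)%:E)%E.
  apply/fine_cvgP; split.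
    have [] := bound ((M - `|x|) / 2); try lra.
    move=> N _ hN; exists N => // n /hN /andP[h1 h2].
    by rewrite fin_numE -ltNye -ltey (le_lt_trans h2 (ltry _)) (lt_le_trans (ltNyr _) h1).
  apply/cvgrPdist_le => e e0.
  pose e' := Num.min (e / 2) ((M - `|x|) / 2).
  have [e'1 e'2] : 0 < e' /\ e' < M - `|x|.
    by rewrite /e' lt_min gt_min; split; [apply/andP; split; lra|apply/orP; right; lra].
  have e'e : 2 * e' <= e.
    have : e' <= e / 2 by rewrite ge_min lexx.
    lra.
  have [N _ hN] := bound _ e'1 e'2; exists N => // n /hN /= /andP[h1 h2].
  have fi : (\int[P]_w truncate M (X n w))%E \is a fin_num.
    by rewrite fin_numE -ltNye -ltey (le_lt_trans h2 (ltry _)) (lt_le_trans (ltNyr _) h1).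
  move: h1 h2; rewrite -(fineK fi) !lee_fin ler_distl; lra.
move=> e0 eM; have [G [mG GX PG]] := h _ e0.
have mGC n : measurable (~` G n) by exact: measurableC.
have PGC : fine (P (~` G n)) @[n --> \oo] --> (0 : R).
  have E n : fine (P (~` G n)) = 1 - fine (P (G n)).
    by rewrite probability_setC// fineB// ?fin_num_measure.
  rewrite (_ : (fun n => _) = (fun n => 1 - fine (P (G n)))); last exact/funext.
  rewrite -[X in _ --> X](subrr (1:R)); apply: cvgB; first exact: cvg_cst.
  by move/fine_cvgP: PG => [].
(* Each unit of mass outside G n moves the integral by at most 2 M. *)
have d0 : 0 < e / (2 * M) by rewrite divr_gt0 ?mulr_gt0.
move/cvgrPdist_lt: PGC => /(_ _ d0) [N _ hN]; exists N => // n /hN /=.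
rewrite sub0r normrN ger0_norm; last exact/fine_ge0.
set q := fine _ => qd.
have q0 : 0 <= q by exact/fine_ge0.
have fq : P (~` G n) = q%:E by rewrite fineK// fin_num_measure.
have qM : 2 * M * q < e by rewrite mulrC -ltr_pdivlMr// mulr_gt0.
have [nx1 nx2] : x <= `|x| /\ - x <= `|x| by split; [exact: ler_norm|rewrite -normrN ler_norm].
have inG w : G n w -> ((x - e)%:E <= truncate M (X n w) <= (x + e)%:E)%E.
  move=> /GX; rewrite /truncate; case: (X n w) => [r| |] //=.
  rewrite lte_fin ltr_norml -EFin_min -EFin_max !lee_fin => /andP[h1 h2].
  by rewrite min_l ?max_r; lra.
have anyw w : ((- M)%:E <= truncate M (X n w) <= M%:E)%E.
  by rewrite /truncate le_max lexx/= ge_max ge_min lexx orbT andbT lee_fin; lra.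
have ind_int : P.-integrable [set: T] (fun w => (\1_(~` G n) w)%:E).
  apply: integrable_indic => //.
have int_ind a b : (\int[P]_w (a + b * \1_(~` G n) w)%:E = (a + b * q)%:E)%E.
  under eq_integral do rewrite EFinD EFinM.
  rewrite integralD//.
  - have -> : (\int[P]__ a%:E = a%:E)%E by have := expectation_cst P a; rewrite unlock.
    rewrite integralZl//.
      transitivity (a%:E + b%:E * P (~` G n))%E; last by rewrite fq.
      by rewrite integral_indic// setIT.
  - by apply: (finite_measure_integrable_cst P a).
  - by apply: integrableZl => //; exact: ind_int.
apply/andP; split.
  apply: (@le_trans _ _ (\int[P]_w ((x - e) + (- (M + x - e)) * \1_(~` G n) w)%:E)%E).
    rewrite int_ind lee_fin; nra.
  apply: le_integral_any => w; rewrite indicE; case: (boolP (w \in ~` G n)).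
    move=> _; rewrite mulr1; case/andP: (anyw w) => + _; apply: le_trans.
    by rewrite lee_fin; lra.
  rewrite notin_setE => /contrapT /inG /andP[+ _].
  by rewrite mulr0 addr0.
apply: (@le_trans _ _ (\int[P]_w ((x + e) + (M - x - e) * \1_(~` G n) w)%:E)%E); last first.
  rewrite int_ind lee_fin; nra.
apply: le_integral_any => w; rewrite indicE; case: (boolP (w \in ~` G n)).
  move=> _; rewrite mulr1; case/andP: (anyw w) => _ +; move/le_trans; apply.
  by rewrite lee_fin; lra.
rewrite notin_setE => /contrapT /inG /andP[_ +].
by rewrite mulr0 addr0.
Qed.

Lemma concentrates_at_cvg_prob (X : nat -> T -> \bar R) (Y : nat -> T -> R) x :
  cvg_prob Y x -> whp (fun n w => X n w = (Y n w)%:E) -> concentrates_at P X x.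
Proof.
move=> hY hE; apply: concentrates_at_whp => e e0.
apply: whp_mono (whpI hE (cvg_prob_dist hY e0)) _.
by apply: nearW => n w [-> ?]; rewrite -EFinB /= lte_fin.
Qed.

End Whp.

(** * The weak law of large numbers *)

Section WeakLaw.
Context (R : realType) (d : measure_display) (T : measurableType d).
Variable P : probability T R.

(** Independence for J = {i, j} makes the joint law of the pair agree with the product of the
    marginals on rectangles, hence everywhere; Tonelli's theorem then splits the integral. *)
Lemma mutually_independent_integralM (I : finType) (X : I -> {RV P >-> R}) (i j : I)
    (f g : R -> R) :
  mutually_independent X -> i != j ->
  measurable_fun [set: R] f -> measurable_fun [set: R] g ->
  (forall x, 0 <= f x) -> (forall x, 0 <= g x) ->
  (\int[P]_w (f (X i w) * g (X j w))%:E =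
   \int[P]_w (f (X i w))%:E * \int[P]_w (g (X j w))%:E)%E.
Proof.
move=> indep ij mf mg f0 g0.
pose XY w := (X i w, X j w).
have mXY : measurable_fun [set: T] XY.
  by apply/measurable_fun_pairP; split; exact: measurable_funPT.
pose F (z : R * R) := (f z.1 * g z.2)%:E.
have mF : measurable_fun [set: R * R] F.
  apply/measurable_EFinP; apply: measurable_funM.
    exact: (measurableT_comp mf measurable_fst).
  exact: (measurableT_comp mg measurable_snd).
have F0 z : (0 <= F z)%E by rewrite lee_fin mulr_ge0.
transitivity (\int[pushforward P XY]_z F z)%E.
  by rewrite ge0_integral_pushforward.
transitivity (\int[distribution P (X i) \x distribution P (X j)]_z F z)%E.
  apply: eq_measure_integral => A mA _; apply/esym.
  apply: product_measure_unique => // B C mB mC.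
  rewrite /pushforward /distribution /pushforward/=.
  have := indep [set i; j]%SET (fun k => if k == i then B else C).
  rewrite big_setU1 ?inE//= big_set1 eqxx eq_sym (negbTE ij) => <-; last by move=> k;
    case: ifP.
  congr (P _); apply/seteqP; split => w /=.
    move=> [wB wC] k /=; rewrite !inE => /orP[/eqP->|/eqP->]; rewrite ?eqxx//.
    by rewrite eq_sym (negbTE ij).
  move=> h; have := h i; have := h j; rewrite /= !inE !eqxx orbT eq_sym (negbTE ij) =>
    /(_ isT) ? /(_ isT) ?.
  by split.
rewrite fubini_tonelli1//.
rewrite -(@ge0_integral_distribution _ _ _ _ _ P (X i) (fun x => (f x)%:E)) ; last 2 first.
- exact/measurable_EFinP.
- by move=> y; rewrite lee_fin.
rewrite -(@ge0_integral_distribution _ _ _ _ _ P (X j) (fun x => (g x)%:E)) ; last 2 first.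
- exact/measurable_EFinP.
- by move=> y; rewrite lee_fin.
rewrite /fubini_F /F /=.
under eq_integral.
  move=> x _; under eq_integral do rewrite EFinM.
  rewrite ge0_integralZl//; last 3 first.
  - exact/measurable_EFinP.
  - by move=> y _; rewrite lee_fin.
  - by rewrite lee_fin.
  over.
rewrite ge0_integralZr//.
- exact/measurable_EFinP.
- by move=> y _; rewrite lee_fin.
- by apply: integral_ge0 => y _; rewrite lee_fin.
Qed.

Lemma standard_normal_integral (X : {RV P >-> R}) (f : R -> R) :
  standard_normal X -> measurable_fun [set: R] f -> (forall x, 0 <= f x) ->
  (\int[P]_w (f (X w))%:E = \int[normal_prob 0 1]_x (f x)%:E)%E.
Proof.
move=> nX mf f0.
(* R carries two measurable structures with convertible measurable sets:
   random variables use the default one, normal_prob uses measurableTypeR. *)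
have mX : measurable_fun [set: T] (X : T -> measurableTypeR R) := @measurable_funPT _ _ _ _ X.
have mf' : measurable_fun [set: measurableTypeR R] f by exact: mf.
transitivity (\int[@pushforward _ _ T (measurableTypeR R) R P X]_x (f x)%:E)%E.
  rewrite ge0_integral_pushforward//; first exact/measurable_EFinP.
  by move=> y; rewrite lee_fin.
by apply: eq_measure_integral => A mA _; exact: nX.
Qed.

(** Chebyshev's inequality: off-diagonal terms of E S^2 reproduce those of M^2, so the variance is
    at most K per diagonal term. *)
Lemma pairwise_uncorrelated_tail (I : finType) (Y : I -> T -> R) (m : I -> R) (K e : R) :
  (forall i, measurable_fun [set: T] (Y i)) -> (forall i w, 0 <= Y i w) ->
  (forall i, \int[P]_w (Y i w)%:E = (m i)%:E)%E ->
  (forall i, \int[P]_w (Y i w ^+ 2)%:E <= K%:E)%E ->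
  (forall i j, i != j -> \int[P]_w (Y i w * Y j w)%:E = (m i * m j)%:E)%E ->
  0 < e ->
  (P [set w | (e <= `|\sum_i Y i w - \sum_i m i|)%R] <= (#|I|%:R * K / e ^+ 2)%:E)%E.
Proof.
move=> mY Y0 EY EY2 EYY e0.
set S := fun w => \sum_i Y i w; set M := \sum_i m i.
have mS : measurable_fun [set: T] S by apply: measurable_sum.
have m0 i : 0 <= m i.
  by rewrite -lee_fin -EY; apply: integral_ge0 => w _; rewrite lee_fin.
have M0 : 0 <= M by apply: sumr_ge0.
have S0 w : 0 <= S w by apply: sumr_ge0.
have ES : (\int[P]_w (S w)%:E = M%:E)%E.
  under eq_integral do rewrite -sumEFin.
  rewrite ge0_integral_sum//.
  - by rewrite -sumEFin; apply: eq_bigr => i _; rewrite EY.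
  - by move=> i; exact/measurable_EFinP.
  - by move=> i w _; rewrite lee_fin.
have ES2 : (\int[P]_w (S w ^+ 2)%:E <= (#|I|%:R * K + M ^+ 2)%:E)%E.
  have sqE w : S w ^+ 2 = \sum_i \sum_j Y i w * Y j w.
    by rewrite expr2 /S big_distrl/=; apply: eq_bigr => i _; rewrite big_distrr.
  under eq_integral do rewrite sqE -sumEFin.
  rewrite ge0_integral_sum//; last 2 first.
  - by move=> i; apply/measurable_EFinP; apply: measurable_sum => j; exact: measurable_funM.
  - by move=> i w _; rewrite lee_fin; apply: sumr_ge0 => j _; rewrite mulr_ge0.
  have -> : #|I|%:R * K + M ^+ 2 = \sum_(i : I) (K + \sum_j m i * m j).
    rewrite big_split/= sumr_const; congr (_ + _).
      by rewrite mulr_natl; congr (_ *+ _); apply: eq_card.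
    by rewrite expr2 /M big_distrl/=; apply: eq_bigr => i _; rewrite big_distrr.
  rewrite -sumEFin; apply: lee_sum => i _.
  under eq_integral do rewrite -sumEFin.
  rewrite ge0_integral_sum//; last 2 first.
  - by move=> j; apply/measurable_EFinP; exact: measurable_funM.
  - by move=> j w _; rewrite lee_fin mulr_ge0.
  rewrite (bigD1 i)//= EFinD leeD//.
    by under eq_integral do rewrite -expr2.
  rewrite (eq_bigr (fun j => (m i * m j)%:E)); last by move=> j ji; rewrite EYY// eq_sym.
  rewrite sumEFin lee_fin [leRHS](bigD1 i)//= lerDr mulr_ge0//.
have mSM : measurable_fun [set: T] (fun w => S w - M) by exact: measurable_funB.
have V : (\int[P]_w ((S w - M) ^+ 2)%:E <= (#|I|%:R * K)%:E)%E.
  (* Subtractions are avoided so that every integrand is nonnegative and no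
     integrability argument is needed. *)
  have E : (\int[P]_w ((S w - M) ^+ 2)%:E + (2 * M * M)%:E = \int[P]_w (S w ^+ 2)%:E + (M
    ^+ 2)%:E)%E.
    rewrite EFinM -ES -ge0_integralZl//; last 3 first.
    - exact/measurable_EFinP.
    - by move=> w _; rewrite lee_fin.
    - by rewrite lee_fin mulr_ge0.
    rewrite -ge0_integralD//; last 4 first.
    - by move=> w _; rewrite lee_fin sqr_ge0.
    - by apply/measurable_EFinP; exact: measurable_funX.
    - by move=> w _; rewrite -EFinM lee_fin !mulr_ge0.
    - by apply/measurable_EFinP; exact: measurable_funM.
    have <- : (\int[P]__ (M ^+ 2)%:E = (M ^+ 2)%:E)%E by have := expectation_cst P (M ^+
      2); rewrite unlock.
    rewrite -ge0_integralD//; last 3 first.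
    - by move=> w _; rewrite lee_fin sqr_ge0.
    - by apply/measurable_EFinP; exact: measurable_funX.
    - by move=> w _; rewrite lee_fin sqr_ge0.
    by apply: eq_integral => w _; rewrite -!EFinM -!EFinD; congr EFin; ring.
  have : (\int[P]_w ((S w - M) ^+ 2)%:E + (2 * M * M)%:E <= (#|I|%:R * K + M ^+ 2)%:E + (M
    ^+ 2)%:E)%E.
    by rewrite E leeD2r.
  rewrite -leeBrDr// => /le_trans; apply.
  rewrite -[leLHS]/((#|I|%:R * K + M ^+ 2 + M ^+ 2 - 2 * M * M)%:E).
  by rewrite lee_fin; lra.
have mA : measurable [set w | e <= `|S w - M|].
  rewrite -[X in measurable X]setTI.
  apply: measurable_fun_le => //.
  exact: measurableT_comp mSM.
rewrite EFinM lee_pdivlMr ?exprn_gt0// muleC.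
apply: le_trans V.
rewrite -[X in (_ * P X <= _)%E]setIT -integral_indic// -ge0_integralZl//; last 2 first.
- exact/measurable_EFinP.
- by rewrite lee_fin sqr_ge0.
apply: ge0_le_integral => //.
- by move=> w _; rewrite -EFinM lee_fin mulr_ge0 ?sqr_ge0.
- by apply/measurable_EFinP; exact: measurable_funM.
- by apply/measurable_EFinP; exact: measurable_funX.
- move=> w _; rewrite -EFinM lee_fin indicE; case: (boolP (w \in _)) => h.
    rewrite mulr1 -[leRHS]real_normK ?num_real// ler_sqr ?nnegrE ?(ltW e0)//.
    by move: h; rewrite inE.
  by rewrite mulr0 sqr_ge0.
Qed.

(** Stated for a triangular array, because the number of entries of g and the split of the
    coordinates of h change with n. The Chebyshev bound is of order 1 / n. *)
Lemma cvg_prob_average (I : nat -> finType) (Y : forall n, I n -> T -> R)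
    (m : forall n, I n -> R) (K mu : R) :
  (forall n, (#|I n| <= n)%N) ->
  (forall n i, measurable_fun [set: T] (Y n i)) -> (forall n i w, 0 <= Y n i w) ->
  (forall n i, \int[P]_w (Y n i w)%:E = (m n i)%:E)%E ->
  (forall n i, \int[P]_w (Y n i w ^+ 2)%:E <= K%:E)%E ->
  (forall n i j, i != j -> \int[P]_w (Y n i w * Y n j w)%:E = (m n i * m n j)%:E)%E ->
  (\sum_i m n i) / n%:R @[n --> \oo] --> mu ->
  cvg_prob P (fun n w => (\sum_i Y n i w) / n%:R) mu.
Proof.
move=> In mY Y0 EY EY2 EYY mmu.
apply: cvg_probP => e e0.
have e20 : 0 < e / 2 by rewrite divr_gt0.
pose A n := [set w | e / 2 * n%:R <= `|\sum_i Y n i w - \sum_i m n i|].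
have mA n : measurable (A n).
  rewrite -[X in measurable X]setTI.
  apply: measurable_fun_le => //.
  by apply: measurableT_comp => //; apply: measurable_funB => //; apply: measurable_sum.
have h : whp P (fun n w => (~` A n) w).
  exists (fun n => ~` A n); split => //; first by move=> n; exact: measurableC.
  have PA0 : P (A n) @[n --> \oo] --> 0%E.
    (* K may be negative when the index sets are all empty; its positive part makes the bound
       monotone in the number of indices. *)
    have K' : (0 <= Num.max K 0) by rewrite le_max lexx orbT.
    apply: (@squeeze_cvge _ _ _ _ (cst 0%E) _ (fun n => ((Num.max K 0 / (e / 2) ^+ 2) *
      n%:R^-1)%:E)); last 2 first.
    - exact: cvg_cst.
    - apply: cvg_EFin; first by apply: nearW.
      rewrite -[X in _ --> X](mulr0 (Num.max K 0 / (e / 2) ^+ 2)); apply: cvgMr.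
      apply/gtr0_cvgV0; last exact: cvgr_idn.
      by near=> n; rewrite ltr0n; near: n; exists 1%N.
    near=> n; rewrite measure_ge0/=.
    have n0 : (0 < n)%N by near: n; exists 1%N.
    have n0' : 0 < n%:R :> R by rewrite ltr0n.
    have := @pairwise_uncorrelated_tail (I n) (Y n) (m n) K (e / 2 * n%:R) (mY n) (Y0 n)
      (EY n) (EY2 n) (EYY n) _.
    move=> /(_ (mulr_gt0 e20 n0')) /le_trans; apply.
    rewrite lee_fin.
    have -> : Num.max K 0 / (e / 2) ^+ 2 / n%:R = n%:R * Num.max K 0 / (e / 2 * n%:R) ^+ 2.
      by field; rewrite !gt_eqF.
    rewrite ler_wpM2r ?invr_ge0 ?sqr_ge0//.
    apply: (@le_trans _ _ (#|I n|%:R * Num.max K 0)).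
      by rewrite ler_wpM2l// le_max lexx.
    by rewrite ler_wpM2r// ler_nat.
  rewrite (_ : (fun n => _) = (fun n => 1 - P (A n))%E); last first.
    by apply/funext => n; rewrite probability_setC.
  rewrite -[X in _ --> X]sube0; apply: cvgeB => //; exact: cvg_cst.
apply: whp_mono h _.
move/cvgrPdist_lt: mmu => /(_ _ e20) mmu.
near=> n => w /= /negP; rewrite -ltNge => An.
have n0 : 0 < n%:R :> R by rewrite ltr0n; near: n; exists 1%N.
have h1 : `|mu - (\sum_i m n i) / n%:R| < e / 2 by near: n.
have h2 : `|(\sum_i Y n i w) / n%:R - (\sum_i m n i) / n%:R| < e / 2.
  by rewrite -mulrBl normrM [X in _ * X]gtr0_norm ?invr_gt0// ltr_pdivrMr.
by move: h1 h2; rewrite !ltr_norml; lra.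
Unshelve. all: by end_near. Qed.

End WeakLaw.

(** * The limit problem *)

Section Scalar.
Variable R : realType.
Local Notation p := (normal_pdf (0 : R) 1).
Implicit Types alpha beta sigma rsc theta c x y : R.

Definition dgauss_excess c := 2 * c * (1 - halfnormal_cdf c) - 4 * p c.

Lemma is_derive_gauss_excess x : 0 < x -> is_derive x 1 (@gauss_excess R) (dgauss_excess x).
Proof.
move=> x0; have d1 := is_derive_halfnormal_cdf x0; have d2 := is_derive_normal_pdf01 x.
rewrite /gauss_excess /dgauss_excess; apply: is_derive_eq; rewrite /GRing.scale/=.
by set q := p x; set F := halfnormal_cdf x; ring.
Qed.

Lemma is_derive_dgauss_excess x : 0 < x -> is_derive x 1 dgauss_excess (2 * (1 -
  halfnormal_cdf x)).
Proof.
move=> x0; have d1 := is_derive_halfnormal_cdf x0; have d2 := is_derive_normal_pdf01 x.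
rewrite /dgauss_excess; apply: is_derive_eq; rewrite /GRing.scale/=.
by set q := p x; set F := halfnormal_cdf x; ring.
Qed.

Lemma MVT_gt0 (f df : R -> R) x y : 0 < x -> x < y ->
  (forall z : R, 0 < z -> is_derive z 1 f (df z)) ->
  exists2 z, x < z < y & f y - f x = df z * (y - x).
Proof.
move=> x0 xy fd.
have [||z] := @MVT R f df x y xy.
- by move=> z; rewrite in_itv/= => /andP[xz _]; apply: fd; exact: lt_trans xz.
- apply: derivable_within_continuous => z; rewrite in_itv/= => /andP[xz _].
  by have [] := fd z (lt_le_trans x0 xz).
by rewrite in_itv/= => zxy fE; exists z.
Qed.

Lemma dgauss_excess_le x y : 0 < x -> x < y -> dgauss_excess x <= dgauss_excess y.
Proof.
move=> x0 xy; have [z /andP[xz _] E] := MVT_gt0 x0 xy is_derive_dgauss_excess.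
rewrite -subr_ge0 E mulr_ge0 ?subr_ge0 ?(ltW xy)// mulr_ge0// subr_ge0 halfnormal_cdf_le1//.
exact/ltW/(lt_trans x0).
Qed.

Lemma gauss_excess_tangent x y : 0 < x -> 0 < y ->
  gauss_excess x + dgauss_excess x * (y - x) <= gauss_excess y.
Proof.
move=> x0 y0; have [xy|yx|->] := ltgtP x y.
- have [z /andP[xz _] E] := MVT_gt0 x0 xy is_derive_gauss_excess.
  rewrite -lerBrDl E ler_wpM2r ?subr_ge0 ?(ltW xy)//; exact: dgauss_excess_le.
- have [z /andP[yz zx] E] := MVT_gt0 y0 yx is_derive_gauss_excess.
  have := dgauss_excess_le (lt_trans y0 yz) zx.
  rewrite -(ler_pM2r (_ : 0 < x - y)) ?subr_gt0//; lra.
- by rewrite subrr mulr0 addr0.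
Qed.

Definition psi beta c := (1 - beta) * gauss_excess c + beta * (1 + c ^+ 2).

Definition dpsi beta c := (1 - beta) * dgauss_excess c + 2 * beta * c.

(** The quadratic term is the exact remainder of beta (1 + c^2); the excess part contributes plain
    convexity. *)
Lemma psi_tangent beta x y : beta < 1 -> 0 < x -> 0 < y ->
  psi beta x + dpsi beta x * (y - x) + beta * (y - x) ^+ 2 <= psi beta y.
Proof.
move=> b1 x0 y0; have := gauss_excess_tangent x0 y0.
rewrite -(ler_pM2l (_ : 0 < 1 - beta)) ?subr_gt0// /psi /dpsi; lra.
Qed.

Lemma psi_cvg beta x : 0 < x -> psi beta y @[y --> x] --> psi beta x.
Proof.
move=> x0; apply: cvgD.
  by apply: cvgMr; exact: is_derive_cvg (is_derive_gauss_excess x0).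
apply: cvgMr; apply: cvgD; first exact: cvg_cst.
exact: exprn_continuous.
Qed.

(** * Closed forms at the point F(theta) *)

Section AtTheta.
Variables beta theta : R.
Hypotheses (bt : beta < theta) (t1 : theta <= 1).
Local Notation c := (Ffun beta theta).
Local Notation C := (Cfun beta theta).

Let y01 : 0 <= (1 - theta) / (1 - beta) < 1.
Proof.
by move: bt t1 => *; rewrite divr_ge0/= ?ltr_pdivrMr ?mul1r//; lra.
Qed.

Let b1 : 0 < 1 - beta. Proof. by move: bt t1 => *; lra. Qed.

Let sq2 : 0 < Num.sqrt 2 :> R. Proof. by rewrite sqrtr_gt0. Qed.

Lemma Ffun_ge0 : 0 <= c.
Proof. by rewrite mulr_ge0// ?(ltW sq2)// erfinv_ge0. Qed.

(** This gives theta its meaning: theta - beta is the limiting proportion, among all n coordinates,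
    of those in the first n - k with |h_i| > F(theta), whose residual no admissible lambda cancels
    at nu = 1 / F(theta). *)
Lemma halfnormal_cdf_Ffun : (1 - beta) * (1 - halfnormal_cdf c) = theta - beta.
Proof.
rewrite /halfnormal_cdf /Ffun mulrAC divff ?gt_eqF// mul1r erfinvK//.
by field; rewrite gt_eqF.
Qed.

Lemma Cfun_pdf : C = 2 * (1 - beta) * p c.
Proof.
rewrite /Cfun normal_pdf01E /Ffun exprMn sqr_sqrtr//.
have -> : - (2 * erfinv ((1 - theta) / (1 - beta)) ^+ 2 / 2) =
  - erfinv ((1 - theta) / (1 - beta)) ^+ 2 by field.
set e := expR _.
have pi0 : 0 < pi :> R := pi_gt0 R.
have sp : 0 < Num.sqrt pi :> R by rewrite sqrtr_gt0.
rewrite !sqrtrM// sqrtrV ?ltW//.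
have E2 : Num.sqrt 2 ^+ 2 = 2 :> R by rewrite sqr_sqrtr.
have a0 : Num.sqrt 2 != 0 :> R by rewrite gt_eqF.
have b0 : Num.sqrt pi != 0 :> R by rewrite gt_eqF.
set a := Num.sqrt 2 in E2 a0 *; set b := Num.sqrt pi in b0 *.
transitivity (a ^+ 2 * (1 - beta) * ((a * b)^-1 * e)); last by rewrite E2.
by field; rewrite a0 b0.
Qed.

Lemma Cfun_gt0 : 0 < C.
Proof.
rewrite /Cfun !mulr_gt0// ?expR_gt0// sqrtr_gt0 divr_gt0//; exact: pi_gt0.
Qed.

(** Here erfinv is nonnegative, so the square root in D is F(theta) and its quotient by the
    exponential is a multiple of F(theta) C. Later identities thereby become polynomial in theta, c
    and C. *)
Lemma Dfun_Ffun : Dfun beta theta = theta + c * C.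
Proof.
have e0 := erfinv_ge0 y01.
rewrite /Dfun /Cfun /Ffun [Num.sqrt (2 * erfinv _ ^+ 2)]sqrtrM// sqrtr_sqr ger0_norm// expRN.
have pi0 : 0 < pi :> R := pi_gt0 R.
have sp : 0 < Num.sqrt pi :> R by rewrite sqrtr_gt0.
rewrite [Num.sqrt (2 * pi)]sqrtrM// [Num.sqrt (2 / pi)]sqrtrM// sqrtrV ?ltW//.
have E2 : Num.sqrt 2 ^+ 2 = 2 :> R by rewrite sqr_sqrtr.
have g0 : expR (erfinv ((1 - theta) / (1 - beta)) ^+ 2) != 0 by rewrite gt_eqF// expR_gt0.
set E := expR _ in g0 *; set x := erfinv _ in e0 *; have a0 : Num.sqrt 2 != 0 :> R by
  rewrite gt_eqF.
have b0 : Num.sqrt pi != 0 :> R by rewrite gt_eqF.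
set a := Num.sqrt 2 in E2 a0 *; set b := Num.sqrt pi in b0 *.
have b10 : 1 - beta != 0 by rewrite gt_eqF.
have -> : (1 - beta) / (a * b) * (a * b + 2 * (a * x / E) - a * b * ((1 - theta) / (1 -
  beta))) + beta
  = theta + (1 - beta) * 2 / b * x / E by field; rewrite a0 b0 b10 g0.
have -> : a * x * ((1 - beta) * (a * b^-1) * E^-1) = a ^+ 2 * x * (1 - beta) / b / E.
  by field; rewrite b0 g0.
by rewrite E2; field; rewrite b0 g0.
Qed.

Lemma psi_Ffun : psi beta c = theta * (1 + c ^+ 2) - c * C.
Proof.
rewrite /psi /gauss_excess Cfun_pdf.
have := halfnormal_cdf_Ffun; set F := halfnormal_cdf c; set q := p c; set z := c => e.
have -> : (1 - beta) * ((1 + z ^+ 2) * (1 - F) - 2 * z * q) =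
  (1 + z ^+ 2) * ((1 - beta) * (1 - F)) - 2 * z * q * (1 - beta) by ring.
by rewrite e; ring.
Qed.

Lemma dpsi_Ffun : dpsi beta c = 2 * (theta * c - C).
Proof.
rewrite /dpsi /dgauss_excess Cfun_pdf.
have := halfnormal_cdf_Ffun; set F := halfnormal_cdf c; set q := p c; set z := c => e.
have -> : (1 - beta) * (2 * z * (1 - F) - 4 * q) =
  2 * z * ((1 - beta) * (1 - F)) - 4 * q * (1 - beta) by ring.
by rewrite e; ring.
Qed.

End AtTheta.

(** The fundamental equation reads C = alphaw F(alphaw), which by [dpsi_Ffun] is psi' = 0 at
    F(alphaw). So alphaw is the minimum of psi on the positive axis, and the limit radicand is
    positive somewhere exactly when alpha exceeds it. *)
Lemma psi_alpha_w beta alphaw : 0 < beta -> is_alpha_w beta alphaw ->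
  0 < Ffun beta alphaw /\ psi beta (Ffun beta alphaw) = alphaw.
Proof.
move=> b0 [ba a1 E]; have a0 : 0 < alphaw by apply: lt_trans ba.
have CF : Cfun beta alphaw = alphaw * Ffun beta alphaw.
  move/eqP: E; rewrite subr_eq0 => /eqP E; rewrite /Ffun -E /Cfun.
  by field; rewrite gt_eqF.
have c0 : 0 < Ffun beta alphaw.
  by have := Cfun_gt0 ba a1; rewrite CF pmulr_rgt0.
by split => //; rewrite psi_Ffun// CF; ring.
Qed.

Definition limit_radicand alpha beta (nu : R) := nu ^+ 2 * (alpha - psi beta nu^-1).

Definition limit_value alpha beta sigma rsc (nu : R) :=
  sigma * Num.sqrt (limit_radicand alpha beta nu) - nu * rsc.

Lemma limit_radicand_cvg alpha beta (nu : R) : 0 < nu ->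
  limit_radicand alpha beta x @[x --> nu] --> limit_radicand alpha beta nu.
Proof.
move=> nu0; apply: cvgM; first exact: exprn_continuous.
apply: cvgB; first exact: cvg_cst.
apply: (@continuous_comp _ _ _ (fun x : R => x^-1) (psi beta)).
  by apply: inv_continuous; rewrite gt_eqF.
by apply: psi_cvg; rewrite invr_gt0.
Qed.

Lemma limit_value_cvg alpha beta sigma rsc (nu : R) : 0 < nu ->
  limit_value alpha beta sigma rsc x @[x --> nu] --> limit_value alpha beta sigma rsc nu.
Proof.
move=> nu0; apply: cvgB; last by apply: cvgM; [exact: cvg_id|exact: cvg_cst].
apply: cvgMr; apply: (@continuous_comp _ _ _ (limit_radicand alpha beta) Num.sqrt);
  last exact: sqrt_continuous.
exact: limit_radicand_cvg.
Qed.

(** * The strict local maximum of the limit value *)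

Section Optimum.
Variables alpha beta alphaw sigma rsc theta : R.
Hypotheses (beta_gt0 : 0 < beta) (alphawP : is_alpha_w beta alphaw)
  (below : alphaw < alpha) (sigma_gt0 : 0 < sigma) (rsc_gt0 : 0 < rsc)
  (thetaP : is_theta_hat alpha beta sigma rsc theta).

Local Notation c := (Ffun beta theta).
Local Notation C := (Cfun beta theta).
Local Notation D := (Dfun beta theta).
Local Notation nu := (nu_root alpha beta sigma rsc theta).
Let u := sigma / rsc.

Lemma nu_root_gt0 : 0 < nu.
Proof.
have [[bt t1] _ e] := thetaP; have c0 := Ffun_ge0 bt t1.
have cn : c != 0 by apply/eqP => z; move: e; rewrite z mul0r => /eqP; rewrite eq_sym oner_eq0.
by rewrite -(pmulr_rgt0 _ (_ : 0 < c)) ?e// lt_def cn.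
Qed.

Lemma nu_rootV : nu^-1 = c.
Proof. by have [_ _ e] := thetaP; rewrite -[LHS]mul1r -e mulfK// gt_eqF// nu_root_gt0. Qed.

Lemma limit_radicand_nu_root :
  limit_radicand alpha beta nu = alpha * nu ^+ 2 - (nu ^+ 2 * D - 2 * nu * C + theta).
Proof.
have [[bt t1] _ e] := thetaP.
rewrite /limit_radicand nu_rootV psi_Ffun// Dfun_Ffun//.
have -> : nu ^+ 2 * (alpha - (theta * (1 + c ^+ 2) - c * C)) =
  nu ^+ 2 * alpha - theta * nu ^+ 2 - theta * (c * nu) ^+ 2 + (c * nu) * nu * C by ring.
have -> : nu ^+ 2 * (theta + c * C) = nu ^+ 2 * theta + (c * nu) * nu * C by ring.
by rewrite e; ring.
Qed.

(** Half the derivative of the limit radicand at nu, so that stationarity of f says that the root of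
    the radicand is u w. In the notation of the theorem, u w is A nu + B. *)
Let w := (alpha - D) * nu + C.

(** The quadratic equation solved by [nu_root] is (A nu + B)^2 = limit radicand, the square of the
    stationarity equation; the sign chosen for the root determines the sign of w. *)
Lemma limit_stationary : 0 < w /\ limit_radicand alpha beta nu = (u * w) ^+ 2.
Proof.
have [[bt t1] [disc0 den0] e] := thetaP; have n0 := nu_root_gt0.
have C0 := Cfun_gt0 bt t1.
have bt1 : beta < 1 by apply: lt_le_trans t1.
have u0 : 0 < u by rewrite divr_gt0.
have AE : Afun alpha beta sigma rsc theta = u * (alpha - D) by rewrite /Afun /u; ring.
have BE : Bfun beta sigma rsc theta = u * C by rewrite /Bfun /u; ring.
have denE : nu_den alpha beta sigma rsc theta = u ^+ 2 * (alpha - D) ^+ 2 - (alpha - D).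
  by rewrite /nu_den AE; ring.
have rootE : nu_den alpha beta sigma rsc theta * nu + (u ^+ 2 * (alpha - D) * C - C) = -
  Num.sqrt (nu_disc alpha beta sigma rsc theta).
  by rewrite /nu_root mulrC divfK// AE BE; ring.
have radE := limit_radicand_nu_root.
have quad : limit_radicand alpha beta nu = (u * w) ^+ 2.
  have : (nu_den alpha beta sigma rsc theta * nu + (u ^+ 2 * (alpha - D) * C - C)) ^+ 2 =
    nu_disc alpha beta sigma rsc theta.
    by rewrite rootE sqrrN sqr_sqrtr.
  rewrite /nu_disc AE BE => q.
  have : nu_den alpha beta sigma rsc theta * ((u * w) ^+ 2 - limit_radicand alpha beta nu) = 0.
    rewrite radE /w; move: q; rewrite denE; set X := alpha - D => q.
    have -> : alpha * nu ^+ 2 - (nu ^+ 2 * D - 2 * nu * C + theta) = X * nu ^+ 2 + 2 * nu *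
      C - theta by rewrite /X; ring.
    move: q; set N := nu => q.
    by move/eqP: q; rewrite -subr_eq0 => /eqP <-; ring.
  by move/eqP; rewrite mulf_eq0 (negbTE den0)/= subr_eq0 => /eqP.
(* Excludes the extraneous root introduced by squaring the stationarity
   equation sigma * w = rsc * sqrt (limit_radicand nu). *)
have sgn : (u ^+ 2 * (alpha - D) - 1) * w <= 0.
  have -> : (u ^+ 2 * (alpha - D) - 1) * w = - Num.sqrt (nu_disc alpha beta sigma rsc theta).
    by rewrite -rootE denE /w; ring.
  by rewrite oppr_le0 sqrtr_ge0.
have w0 : 0 <= w.
  (* If w < 0, [sgn] forces alpha - D >= 1 / u^2 > 0, but then w is a sum of positive terms. *)
  rewrite leNgt; apply/negP => wn.
  have X1 : 0 <= u ^+ 2 * (alpha - D) - 1 by move: sgn; rewrite nmulr_lle0.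
  have X0 : 0 < alpha - D.
    by rewrite -(pmulr_rgt0 _ (_ : 0 < u ^+ 2)) ?exprn_gt0//; lra.
  by move: wn; rewrite /w ltNge (addr_ge0 (mulr_ge0 (ltW X0) (ltW n0)) (ltW C0)).
split=> //; rewrite lt_def w0 andbT; apply/eqP => wz.
(* If w = 0, then psi = alpha and psi' = 0 at c, so convexity gives psi >= alpha everywhere,
   contradicting the value alphaw < alpha at F(alphaw). *)
have r0 : limit_radicand alpha beta nu = 0 by rewrite quad wz mulr0 expr0n.
have psiE : psi beta c = alpha.
  move/eqP: r0; rewrite /limit_radicand nu_rootV mulf_eq0 sqrf_eq0 gt_eqF//= subr_eq0.
  by move/eqP.
have dz : dpsi beta c = 0.
  rewrite dpsi_Ffun//; have : nu * w + (nu * C - theta) = 0 by rewrite -r0 radE /w; ring.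
  rewrite wz mulr0 add0r => ez.
  have -> : 2 * (theta * c - C) = - 2 * c * (nu * C - theta) + 2 * (c * nu - 1) * C by ring.
  by rewrite e ez; ring.
have [cw0 cwE] := psi_alpha_w beta_gt0 alphawP.
have c0 : 0 < c by rewrite -nu_rootV invr_gt0.
have := psi_tangent bt1 c0 cw0; rewrite cwE psiE dz.
have := mulr_ge0 (ltW beta_gt0) (sqr_ge0 (Ffun beta alphaw - c)).
by move: below => ?; lra.
Qed.

(** The tangent [tau] has slope 1 / u = rsc / sigma, so sigma tau - x rsc equals f(nu) for every x.
    It remains to compare the radicand with the square of [tau], which requires tau > 0: hence the
    lower bound on x - nu. *)
Lemma limit_value_lt (x : R) : 0 < x -> x != nu -> - (u ^+ 2 * w) < x - nu ->
  limit_value alpha beta sigma rsc x < limit_value alpha beta sigma rsc nu.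
Proof.
move=> x0 xn xw; have [w0 radE] := limit_stationary.
have [[bt t1] _ e] := thetaP; have n0 := nu_root_gt0.
have bt1 : beta < 1 by apply: lt_le_trans t1.
have u0 : 0 < u by rewrite divr_gt0.
have c0 : 0 < c by rewrite -nu_rootV invr_gt0.
(* The tangent at nu to the square root of the limit radicand. *)
pose tau := u * w + (x - nu) / u.
have tau0 : 0 < tau.
  rewrite -(pmulr_rgt0 _ u0) [ltRHS](_ : _ = u ^+ 2 * w + (x - nu)); first lra.
  by rewrite /tau; field; rewrite gt_eqF.
have radn : nu ^+ 2 * (alpha - psi beta c) = (u * w) ^+ 2 by rewrite -radE /limit_radicand
  nu_rootV.
have lt2 : limit_radicand alpha beta x < tau ^+ 2.
  have := psi_tangent bt1 c0 (_ : 0 < x^-1); rewrite invr_gt0 => /(_ x0) tan.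
  have le1 : limit_radicand alpha beta x <= x ^+ 2 * (alpha - (psi beta c + dpsi beta c *
    (x^-1 - c) + beta * (x^-1 - c) ^+ 2)).
    by rewrite /limit_radicand ler_pM2l ?exprn_gt0// lerD2l lerN2.
  apply: (le_lt_trans le1); rewrite -subr_gt0.
  (* P is w / nu and z is c psi'(c) / 2; in these terms stationarity becomes P - z = (u P)^2. *)
  pose P := alpha - theta; pose z := c * (theta * c - C).
  have wE : w = P * nu.
    rewrite /w /P Dfun_Ffun//.
    have -> : (alpha - (theta + c * C)) * nu + C = (alpha - theta) * nu + (1 - c * nu) * C
      by ring.
    by rewrite e subrr mul0r addr0.
  have psiE : alpha - psi beta c = P - z by rewrite psi_Ffun// /P /z; ring.
  have cE : c = nu^-1 by rewrite nu_rootV.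
  have rE : P - z = u ^+ 2 * P ^+ 2.
    move: radn; rewrite psiE wE => rr.
    apply: (@mulfI _ (nu ^+ 2)); first by rewrite gt_eqF// exprn_gt0.
    by rewrite rr; ring.
  have P0 : 0 < P by rewrite -(pmulr_lgt0 _ n0) -wE.
  (* Both terms are polynomials of degree at most 2 in x that agree to first order at nu, so a
     multiple of (x - nu)^2 is left. Its coefficient turns out to be a square plus the strong
     convexity term beta c^2. *)
  have -> : tau ^+ 2 - x ^+ 2 * (alpha - (psi beta c + dpsi beta c * (x^-1 - c) + beta *
    (x^-1 - c) ^+ 2))
     = (x - nu) ^+ 2 * ((u ^+ 2)^-1 - (P + z) + beta * c ^+ 2).
    rewrite opprD addrA opprD addrA psiE dpsi_Ffun//.
    have -> : theta * c - C = z * nu by rewrite /z cE; field; rewrite gt_eqF.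
    rewrite /tau wE rE cE; clear -u0 n0 x0 rE.
    have zE : z = P - u ^+ 2 * P ^+ 2 by lra.
    rewrite zE; move: P u0 n0 x0 {rE zE} => P; set N := nu; set U := u => u0 n0 x0.
    by field; rewrite !gt_eqF.
  apply: mulr_gt0; first by rewrite exprn_even_gt0//= subr_eq0.
  have zE : z = P - u ^+ 2 * P ^+ 2 by lra.
  have b0 : 0 < beta * c ^+ 2 by rewrite mulr_gt0// exprn_gt0.
  have -> : (u ^+ 2)^-1 - (P + z) = (u^-1 - u * P) ^+ 2.
    by rewrite zE; field; rewrite gt_eqF.
  by rewrite ltr_wpDl// sqr_ge0.
have lt1 : Num.sqrt (limit_radicand alpha beta x) < tau.
  by rewrite -[ltRHS]ger0_norm ?(ltW tau0)// -sqrtr_sqr ltr_sqrt// exprn_gt0.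
rewrite /limit_value radE sqrtr_sqr ger0_norm ?(mulr_ge0 (ltW u0) (ltW w0))//.
have : sigma * Num.sqrt (limit_radicand alpha beta x) < sigma * tau by rewrite ltr_pM2l.
have -> : sigma * tau = sigma * (u * w) + rsc * (x - nu).
  by rewrite /tau /u; field; rewrite !gt_eqF.
lra.
Qed.

Lemma limit_optimum : exists2 d, 0 < d & forall x, 0 < x -> x != nu -> `|x - nu| < d ->
  limit_value alpha beta sigma rsc x < limit_value alpha beta sigma rsc nu.
Proof.
have [w0 _] := limit_stationary; exists (u ^+ 2 * w).
  by rewrite mulr_gt0// exprn_gt0// divr_gt0.
by move=> x x0 xn; rewrite ltr_norml => /andP[xl _]; exact: limit_value_lt.
Qed.

Lemma limit_radicand_gt0 : 0 < limit_radicand alpha beta nu.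
Proof.
have [w0 ->] := limit_stationary; rewrite exprn_gt0// mulr_gt0//.
by rewrite divr_gt0.
Qed.

End Optimum.
End Scalar.

(** * The program for fixed g and h *)

Section Program.
Variables (R : realType) (m n k : nat) (sigma r : R) (g : 'cV[R]_m) (h : 'cV[R]_n).
Hypothesis sigma_gt0 : 0 < sigma.
Implicit Type p q : R * 'cV[R]_n.

Local Notation feasible := (feasible k g h).
Local Notation objective := (objective sigma r g h).
Local Notation radicand := (radicand g h).
Local Notation resid := (resid h).

(** On a free coordinate 1 - lambda_i ranges over [-1, 1], so the smallest residual is the distance
    from nu h_i to [-1, 1]. *)
Definition min_dist (nu : R) : R := \sum_(i < n)
  (if (i < n - k)%N then Num.max (`|nu * h i 0| - 1) 0 ^+ 2 else (nu * h i 0 + 1) ^+ 2).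

Definition best_lambda (nu : R) : 'cV[R]_n := \col_i
  (if (i < n - k)%N then Num.min (Num.max (nu * h i 0 + 1) 0) 2 else 0).

(** Where the radicand is negative [Num.sqrt] returns 0: the value then belongs to no feasible
    point, but the function stays continuous on the whole line. *)
Definition best_value (nu : R) : R :=
  sigma * Num.sqrt (sqnorm2 g * nu ^+ 2 - min_dist nu) - nu * r.

Lemma norm2_sqr (j : nat) (v : 'cV[R]_j) : norm2 v ^+ 2 = sqnorm2 v.
Proof. by rewrite sqr_sqrtr// sumr_ge0// => i _; rewrite sqr_ge0. Qed.

Lemma radicandE p : radicand p = sqnorm2 g * p.1 ^+ 2 - sqnorm2 (resid p).
Proof. by rewrite /radicand !norm2_sqr. Qed.

Lemma residE p i : resid p i 0 = p.1 * h i 0 + 1 - p.2 i 0.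
Proof. by rewrite !mxE. Qed.

Lemma feasible_min_dist p : feasible p -> min_dist p.1 <= sqnorm2 (resid p).
Proof.
move=> [_ l0 l2 _]; apply: ler_sum => i _; rewrite residE; case: ifPn => ik.
  have /andP[a b] := l2 i ik; set u := p.1 * h i 0.
  have [c|c] := leP (`|u| - 1) 0; first by rewrite expr0n/= sqr_ge0.
  rewrite -[leRHS]real_normK ?num_real// ler_sqr ?nnegrE ?(ltW c)//.
  by move: c; case: (leP 0 u) => u0;
    [rewrite (ger0_norm u0)|rewrite (ltr0_norm u0)] => c; rewrite ler_normr; apply/orP; lra.
by rewrite l0 ?subr0// leqNgt.
Qed.

Lemma objective_le_best p : feasible p -> objective p <= best_value p.1.
Proof.
move=> fp; rewrite lerD2r ler_pM2l// ler_wsqrtr// radicandE lerD2l lerN2.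
exact: feasible_min_dist.
Qed.

Lemma best_residE nu : sqnorm2 (resid (nu, best_lambda nu)) = min_dist nu.
Proof.
apply: eq_bigr => i _; rewrite residE !mxE/=; case: ifPn => ik; last by rewrite subr0.
set u := nu * h i 0.
have [u0|u0] := leP 0 u.
  rewrite ger0_norm// [Num.max (u + 1) 0]max_l; last lra.
  have [c|c] := leP (u - 1) 0; first by rewrite min_l; [rewrite subrr expr0n|lra].
  by rewrite min_r; [ring|lra].
rewrite ltr0_norm//.
have [c|c] := leP (- u - 1) 0.
  rewrite [Num.max (u + 1) 0]max_l; last lra.
  by rewrite min_l; [rewrite subrr expr0n|lra].
rewrite [Num.max (u + 1) 0]max_r; last lra.
by rewrite min_l; [ring|lra].
Qed.

Lemma best_objectiveE nu : objective (nu, best_lambda nu) = best_value nu.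
Proof. by rewrite /Defs.objective radicandE best_residE. Qed.

Lemma best_feasible nu : 0 <= nu -> 0 <= sqnorm2 g * nu ^+ 2 - min_dist nu ->
  feasible (nu, best_lambda nu).
Proof.
move=> nu0 s0; split => //= [i ik|i ik|].
- by rewrite mxE ltnNge ik.
- by rewrite mxE ik le_min ge_min lexx !le_max lexx !orbT ler0n.
- by rewrite radicandE best_residE.
Qed.

Definition mix (t : R) p q := (t * p.1 + (1 - t) * q.1, t *: p.2 + (1 - t) *: q.2).

Lemma resid_mix t p q i :
  resid (mix t p q) i 0 = t * resid p i 0 + (1 - t) * resid q i 0.
Proof. by rewrite !residE /mix/= !mxE; ring. Qed.

(* Reverse Cauchy-Schwarz inequality in the Lorentz cone. *)
Lemma radicand_mix t p q : 0 <= t <= 1 -> feasible p -> feasible q ->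
  (t * Num.sqrt (radicand p) + (1 - t) * Num.sqrt (radicand q)) ^+ 2
  <= radicand (mix t p q).
Proof.
move=> /andP[t0 t1] [p0 _ _ rp] [q0 _ _ rq].
set G := sqnorm2 g; pose xy := \sum_(i < n) resid p i 0 * resid q i 0.
have mixE : radicand (mix t p q) = t ^+ 2 * radicand p + (1 - t) ^+ 2 * radicand q
    + 2 * t * (1 - t) * (G * p.1 * q.1 - xy).
  have -> : radicand (mix t p q) = G * (t * p.1 + (1 - t) * q.1) ^+ 2 -
     (t ^+ 2 * sqnorm2 (resid p) + (1 - t) ^+ 2 * sqnorm2 (resid q) + 2 * t * (1 - t) * xy).
    rewrite radicandE; congr (_ - _).
    rewrite /sqnorm2 /xy !big_distrr/= -!big_split/=; apply: eq_bigr => i _.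
    by rewrite resid_mix; ring.
  by rewrite !radicandE -/G; ring.
(* On the boundary nu = 0 feasibility forces a vanishing residual; this leaves positive first
   coordinates, by which one may multiply. *)
have zero u : 0 <= radicand u -> u.1 = 0 -> radicand u = 0 /\ forall i, resid u i 0 = 0.
  move=> + u0; rewrite radicandE u0 expr0n/= mulr0 sub0r oppr_ge0 => S0.
  have S1 : sqnorm2 (resid u) = 0.
    by apply/eqP; rewrite eq_le S0 sumr_ge0// => i _; rewrite sqr_ge0.
  split; first by rewrite S1 oppr0.
  move=> i; apply/eqP; rewrite -sqrf_eq0.
  by move/eqP: S1; rewrite psumr_eq0 => [/allP/(_ i (mem_index_enum _))|j _]; rewrite ?sqr_ge0.
have key : Num.sqrt (radicand p) * Num.sqrt (radicand q) <= G * p.1 * q.1 - xy.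
  have [pz|pnz] := eqVneq p.1 0.
    have [-> x0] := zero p rp pz; rewrite pz sqrtr0 mulr0 !mul0r sub0r oppr_ge0.
    by rewrite /xy big1// => i _; rewrite x0 mul0r.
  have [qz|qnz] := eqVneq q.1 0.
    have [-> x0] := zero q rq qz; rewrite qz sqrtr0 !mulr0 sub0r oppr_ge0.
    by rewrite /xy big1// => i _; rewrite x0 mulr0.
  have pp : 0 < p.1 by rewrite lt_def pnz.
  have qp : 0 < q.1 by rewrite lt_def qnz.
  have sq : 0 <= q.1 ^+ 2 * sqnorm2 (resid p) + p.1 ^+ 2 * sqnorm2 (resid q) - 2 * p.1 *
    q.1 * xy.
    rewrite /sqnorm2 /xy !big_distrr/= -sumrN -!big_split/=; apply: sumr_ge0 => i _.
    have -> : q.1 ^+ 2 * resid p i 0 ^+ 2 + p.1 ^+ 2 * resid q i 0 ^+ 2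
      - 2 * p.1 * q.1 * (resid p i 0 * resid q i 0)
      = (q.1 * resid p i 0 - p.1 * resid q i 0) ^+ 2 by ring.
    exact: sqr_ge0.
  have am : 0 <= (q.1 * Num.sqrt (radicand p) - p.1 * Num.sqrt (radicand q)) ^+ 2 by exact:
    sqr_ge0.
  (* Multiplied by 2 p.1 q.1, the claim is the sum of the nonnegative squares [am] and [sq], with
     a^2 and b^2 replaced by the radicands. *)
  rewrite -(ler_pM2l (_ : 0 < 2 * p.1 * q.1)); last by rewrite !mulr_gt0.
  have Ep := sqr_sqrtr rp; have Eq := sqr_sqrtr rq.
  move: am sq Ep Eq; rewrite !radicandE -/G.
  set a := Num.sqrt _; set b := Num.sqrt _; set X := sqnorm2 (resid p);
    set Y := sqnorm2 (resid q).
  move=> am sq Ep Eq.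
  have am2 : 0 <= q.1 ^+ 2 * a ^+ 2 + p.1 ^+ 2 * b ^+ 2 - 2 * p.1 * q.1 * (a * b).
    by move: am; rewrite (_ : (_ - _) ^+ 2 = q.1 ^+ 2 * a ^+ 2 + p.1 ^+ 2 * b ^+ 2 - 2 *
      p.1 * q.1 * (a * b)); last ring.
  move: am2; rewrite Ep Eq => am2; nra.
rewrite mixE.
have -> : (t * Num.sqrt (radicand p) + (1 - t) * Num.sqrt (radicand q)) ^+ 2 =
  t ^+ 2 * Num.sqrt (radicand p) ^+ 2 + (1 - t) ^+ 2 * Num.sqrt (radicand q) ^+ 2
  + 2 * t * (1 - t) * (Num.sqrt (radicand p) * Num.sqrt (radicand q)) by ring.
rewrite !sqr_sqrtr// lerD2l ler_wpM2l// !mulr_ge0// subr_ge0//.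
Qed.

Lemma feasible_mix t p q : 0 <= t <= 1 -> feasible p -> feasible q -> feasible (mix t p q).
Proof.
move=> t01 fp fq; have rm := radicand_mix t01 fp fq.
case/andP: t01 => t0 t1; have s0 : 0 <= 1 - t by rewrite subr_ge0.
case: fp fq => [p0 pz pb _] [q0 qz qb _]; split => /=.
- by rewrite addr_ge0// mulr_ge0.
- by move=> i ik; rewrite !mxE pz// qz// !mulr0 addr0.
- move=> i ik; rewrite !mxE; have /andP[a b] := pb i ik; have /andP[c e] := qb i ik.
  apply/andP; split; nra.
- exact: le_trans (sqr_ge0 _) rm.
Qed.

Lemma objective_mix t p q : 0 <= t <= 1 -> feasible p -> feasible q ->
  t * objective p + (1 - t) * objective q <= objective (mix t p q).
Proof.
move=> t01 fp fq; have rm := radicand_mix t01 fp fq.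
have [t0 t1] := andP t01; have s0 : 0 <= 1 - t by rewrite subr_ge0.
have key : t * Num.sqrt (radicand p) + (1 - t) * Num.sqrt (radicand q)
    <= Num.sqrt (radicand (mix t p q)).
  rewrite -[leLHS]ger0_norm -?sqrtr_sqr ?ler_wsqrtr// addr_ge0// mulr_ge0//.
rewrite /Defs.objective /mix/=.
rewrite [leLHS](_ : _ = sigma * (t * Num.sqrt (radicand p) + (1 - t) * Num.sqrt (radicand
  q)) - (t * p.1 + (1 - t) * q.1) * r); last ring.
by rewrite lerD2r ler_pM2l.
Qed.

(** The cut-off of the root at 0 means that [best_value] need not be concave, so the chord
    inequality is taken between feasible endpoints. The second conclusion passes feasibility on to
    every nu in between. *)
Lemma objective_chord p q nu : feasible p -> feasible q -> p.1 <= nu <= q.1 -> p.1 < q.1 ->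
  (q.1 - nu) * objective p + (nu - p.1) * objective q <= (q.1 - p.1) * best_value nu
  /\ 0 <= sqnorm2 g * nu ^+ 2 - min_dist nu.
Proof.
move=> fp fq /andP[pn nq] pq; have pq0 : 0 < q.1 - p.1 by rewrite subr_gt0.
pose t := (q.1 - nu) / (q.1 - p.1).
have t01 : 0 <= t <= 1.
  by rewrite divr_ge0 ?subr_ge0 ?(ltW pq)//= ler_pdivrMr// mul1r lerD2l lerN2.
have nuE : (mix t p q).1 = nu by rewrite /mix/= /t; field; rewrite gt_eqF.
have fm := feasible_mix t01 fp fq; split.
  have := le_trans (objective_mix t01 fp fq) (objective_le_best fm); rewrite nuE.
  rewrite -(ler_pM2l pq0); apply: le_trans.
  by rewrite le_eqVlt; apply/orP; left; apply/eqP; rewrite /t; field; rewrite gt_eqF.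
have [_ _ _] := fm; rewrite radicandE nuE => /le_trans; apply.
by rewrite lerD2l lerN2 -nuE; exact: feasible_min_dist.
Qed.

Lemma best_value_continuous : continuous best_value.
Proof.
move=> x; apply: cvgB; last by apply: cvgM; [exact: cvg_id|exact: cvg_cst].
apply: cvgM; first exact: cvg_cst.
apply: (@continuous_comp _ _ _ (fun nu : R => sqnorm2 g * nu ^+ 2 - min_dist nu) Num.sqrt);
  last exact: sqrt_continuous.
apply: cvgB; first by apply: cvgM; [exact: cvg_cst|exact: exprn_continuous].
rewrite /min_dist; apply: cvg_big => [|i _]; first exact: add_continuous.
case: ifPn => ik.
  apply: (@continuous_comp _ _ _ (fun x : R => Num.max (`|x * h i 0| - 1) 0) (fun y => y ^+
    2)); last exact: exprn_continuous.
  apply: continuous_max; last exact: cvg_cst.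
  apply: cvgB; last exact: cvg_cst.
  by apply: cvg_norm; apply: cvgM; [exact: cvg_id|exact: cvg_cst].
apply: (@continuous_comp _ _ _ (fun x : R => x * h i 0 + 1) (fun y => y ^+ 2));
  last exact: exprn_continuous.
apply: cvgD; last exact: cvg_cst.
by apply: cvgM; [exact: cvg_id|exact: cvg_cst].
Qed.

(** Here v, w, o are values at successive points: a concave function that has dropped from v to w
    cannot return to v further out. *)
Lemma chord_lt (a b o v w : R) : 0 < a -> 0 <= b -> w < v ->
  b * v + a * o <= (a + b) * w -> o < v.
Proof.
move=> a0 b0 wv c; rewrite ltNge; apply/negP => vo.
have : a * v <= a * o by rewrite ler_pM2l.
have : (a + b) * w < (a + b) * v by rewrite ltr_pM2l//; lra.
lra.
Qed.

(** Concave extrapolation: w, v, o are values at successive points, and the step b from v to o is no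
    longer than the step a from w to v, so the gain is at most v - w. *)
Lemma chord_le (a b o v w : R) : 0 < a -> 0 <= b <= a -> w <= v ->
  b * w + a * o <= (a + b) * v -> o <= v + (v - w).
Proof.
move=> a0 /andP[b0 ba] wv c; rewrite -(ler_pM2l a0).
have : b * (v - w) <= a * (v - w) by rewrite ler_wpM2r// subr_ge0.
lra.
Qed.

(** * Localizing all solutions from three values of nu *)

Section ThreePoints.
Variables nu0 eps : R.
Hypotheses (eps_gt0 : 0 < eps) (eps_lt : eps < nu0).
Hypothesis s0 : 0 <= sqnorm2 g * nu0 ^+ 2 - min_dist nu0.
Hypothesis sm : 0 <= sqnorm2 g * (nu0 - eps) ^+ 2 - min_dist (nu0 - eps).
Hypothesis sp : 0 <= sqnorm2 g * (nu0 + eps) ^+ 2 - min_dist (nu0 + eps).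
Hypothesis vm : best_value (nu0 - eps) < best_value nu0.
Hypothesis vp : best_value (nu0 + eps) < best_value nu0.

Let f0 : feasible (nu0, best_lambda nu0). Proof. by move: eps_gt0 eps_lt => *;
  apply: best_feasible => //; lra. Qed.
Let fm : feasible (nu0 - eps, best_lambda (nu0 - eps)). Proof. by move: eps_gt0 eps_lt =>
  *; apply: best_feasible => //; lra. Qed.
Let fp : feasible (nu0 + eps, best_lambda (nu0 + eps)). Proof. by move: eps_gt0 eps_lt =>
  *; apply: best_feasible => //; lra. Qed.

Lemma objective_far p : feasible p -> eps <= `|p.1 - nu0| -> objective p < best_value nu0.
Proof.
move: eps_gt0 eps_lt => e0 e1 fq; rewrite ler_normr => /orP[h1|h1].
  have [||c _] := @objective_chord (nu0, best_lambda nu0) p (nu0 + eps) f0 fq;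
    rewrite /= ?best_objectiveE.
  - by apply/andP; split; lra.
  - lra.
  move: c; rewrite /= best_objectiveE => c.
  apply: (@chord_lt eps (p.1 - nu0 - eps) _ _ _ e0 _ vp); lra.
have [||c _] := @objective_chord p (nu0, best_lambda nu0) (nu0 - eps) fq f0;
  rewrite /= ?best_objectiveE.
- by apply/andP; split; lra.
- lra.
move: c; rewrite /= best_objectiveE => c.
apply: (@chord_lt eps (nu0 - eps - p.1) _ _ _ e0 _ vm); lra.
Qed.

(** Extrapolating from the opposite side of nu0 gains at most one of the two differences; their sum
    is a bound valid on both sides. *)
Lemma objective_near p : feasible p -> `|p.1 - nu0| < eps ->
  objective p <= best_value nu0
    + (best_value nu0 - best_value (nu0 - eps)) + (best_value nu0 - best_value (nu0 + eps)).
Proof.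
move: eps_gt0 eps_lt vm vp => e0 e1 v1 v2 fq; rewrite ltr_norml => /andP[h1 h2].
have [h3|h3] := leP nu0 p.1.
  have [||c _] := @objective_chord (nu0 - eps, best_lambda (nu0 - eps)) p nu0 fm fq;
    rewrite /=.
  - by apply/andP; split; lra.
  - lra.
  move: c; rewrite /= best_objectiveE => c.
  suff : objective p <= best_value nu0 + (best_value nu0 - best_value (nu0 - eps)) by lra.
  by apply: (@chord_le eps (p.1 - nu0) _ _ _ e0 _ (ltW v1)); [apply/andP; split; lra|lra].
have [||c _] := @objective_chord p (nu0 + eps, best_lambda (nu0 + eps)) nu0 fq fp; rewrite /=.
- by apply/andP; split; lra.
- lra.
move: c; rewrite /= best_objectiveE => c.
suff : objective p <= best_value nu0 + (best_value nu0 - best_value (nu0 + eps)) by lra.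
by apply: (@chord_le eps (nu0 - p.1) _ _ _ e0 _ (ltW v2)); [apply/andP; split; lra|lra].
Qed.

(** The continuous [best_value] attains its maximum on the interval, at a point that is feasible
    because it lies between feasible endpoints; [objective_far] handles the points outside. *)
Lemma exists_solution : exists p, is_solution k sigma r g h p.
Proof.
move: eps_gt0 eps_lt => e0 e1; have le : nu0 - eps <= nu0 + eps by lra.
have [|nu nuI numax] := @EVT_max R best_value _ _ le.
  by apply: continuous_subspaceT; exact: best_value_continuous.
move: (nuI); rewrite in_itv/= => nuI'.
have fn : feasible (nu, best_lambda nu).
  apply: best_feasible; first by case/andP: nuI' => ? ?; lra.
  by have [|//] := @objective_chord _ _ nu fm fp nuI'; rewrite /=; lra.
exists (nu, best_lambda nu); split => // q fq; rewrite best_objectiveE.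
have [far|near] := leP eps `|q.1 - nu0|.
  apply/ltW/(lt_le_trans (objective_far fq far))/numax.
  by rewrite in_itv/=; apply/andP; split; lra.
apply: (le_trans (objective_le_best fq)); apply: numax.
by rewrite in_itv/=; move: near; rewrite ltr_norml => /andP[? ?]; apply/andP; split; lra.
Qed.

Lemma gen_solution_localized (p := gen_solution k sigma r g h) :
  [/\ feasible p, `|p.1 - nu0| < eps,
    best_value nu0 <= objective p <= best_value nu0
      + (best_value nu0 - best_value (nu0 - eps)) + (best_value nu0 - best_value (nu0 + eps)) &
    xi_prim_gen k sigma r g h = (objective p)%:E].
Proof.
have [fq pmax] : is_solution k sigma r g h p by exact: (xgetPex (0, 0) exists_solution).
have lo : best_value nu0 <= objective p by rewrite -best_objectiveE; exact: pmax _ f0.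
have near : `|p.1 - nu0| < eps.
  by rewrite ltNge; apply/negP => /(objective_far fq); rewrite ltNge lo.
split => //; first by rewrite lo objective_near.
apply/eqP; rewrite eq_le; apply/andP; split.
  by apply: ge_ereal_sup => _ [q fq' <-]; rewrite lee_fin; exact: pmax.
by apply: ereal_sup_ubound; exists p.
Qed.

End ThreePoints.

(** The objective determines the root of the radicand, and the squared residual norm is what the
    radicand leaves of |g|^2 nu^2. So [norm_w_gen] depends only on nu, the optimal value and |g|,
    whose limits are accessible, and no limit of lambda enters. *)
Lemma norm_w_genE (p := gen_solution k sigma r g h) : feasible p ->
  norm_w_gen k sigma r g h =
  sigma * (Num.sqrt (sqnorm2 g * p.1 ^+ 2 - ((objective p + p.1 * r) / sigma) ^+ 2)
           / ((objective p + p.1 * r) / sigma)).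
Proof.
move=> [_ _ _ rp].
have E : (objective p + p.1 * r) / sigma = Num.sqrt (radicand p).
  by rewrite /Defs.objective subrK mulrC mulKf// gt_eqF.
rewrite E sqr_sqrtr// /norm_w_gen -/p; congr (_ * (_ / _)).
by rewrite /norm2 radicandE; congr Num.sqrt; ring.
Qed.

End Program.

(** * Concentration *)

Lemma truncn_ratio_cvg (R : realType) (a : R) : 0 <= a ->
  (Num.truncn (a * n%:R))%:R / n%:R @[n --> \oo] --> a.
Proof.
move=> a0.
have i0 : (n%:R : R)^-1 @[n --> \oo] --> (0 : R).
  apply/gtr0_cvgV0; last exact: cvgr_idn.
  by near=> n; rewrite ltr0n; near: n; exists 1%N.
have lo : a - n%:R^-1 @[n --> \oo] --> a.
  by rewrite -[X in _ --> X]subr0; apply: cvgB => //; exact: cvg_cst.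
apply: (squeeze_cvgr _ lo (cvg_cst a)); near=> n.
have n0 : 0 < n%:R :> R by rewrite ltr0n; near: n; exists 1%N.
have an0 : 0 <= a * n%:R by rewrite mulr_ge0// ltW.
have /andP[t1 t2] := truncn_itv an0.
apply/andP; split; last by rewrite ler_pdivrMr.
rewrite ler_pdivlMr// mulrBl mulVf ?gt_eqF// lerBlDr.
by apply: ltW; move: t2; rewrite -natr1.
Unshelve. all: by end_near. Qed.

Lemma sum_ord_if (R : realType) (n j : nat) (x y : R) : (j <= n)%N ->
  \sum_(i < n) (if (i < j)%N then x else y) = j%:R * x + (n - j)%:R * y.
Proof.
move=> jn; rewrite -(big_mkord xpredT (fun i => if (i < j)%N then x else y)).
rewrite (big_cat_nat (leq0n j) jn)/=.
congr (_ + _).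
  rewrite (eq_big_nat _ _ (F2 := fun=> x)); last by move=> i /andP[_ ->].
  by rewrite sumr_const_nat subn0 mulr_natl.
rewrite (eq_big_nat _ _ (F2 := fun=> y)); last by move=> i /andP[ji _]; rewrite ltnNge ji.
by rewrite sumr_const_nat mulr_natl.
Qed.

(** * Algebra of limits in probability *)

Section CvgProbAlgebra.
Context (R : realType) (d : measure_display) (T : measurableType d).
Variable P : probability T R.
Implicit Types X Y : nat -> T -> R.

Lemma cvg_probD X Y (x y : R) : cvg_prob P X x -> cvg_prob P Y y ->
  cvg_prob P (fun n w => X n w + Y n w) (x + y).
Proof.
move=> hX hY.
by apply: (@cvg_prob_cts2 _ _ _ P R R R (fun z => z.1 + z.2) X Y x y _ hX hY);
  exact: add_continuous.
Qed.

Lemma cvg_probM X Y (x y : R) : cvg_prob P X x -> cvg_prob P Y y ->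
  cvg_prob P (fun n w => X n w * Y n w) (x * y).
Proof.
move=> hX hY.
by apply: (@cvg_prob_cts2 _ _ _ P R R R (fun z => z.1 * z.2) X Y x y _ hX hY);
  exact: mul_continuous.
Qed.

Lemma cvg_prob_cst (x : R) : cvg_prob P (fun _ _ => x) x.
Proof. by apply: (@cvg_prob_det _ _ _ P R (fun=> x)); exact: cvg_cst. Qed.

Lemma cvg_probB X Y (x y : R) : cvg_prob P X x -> cvg_prob P Y y ->
  cvg_prob P (fun n w => X n w - Y n w) (x - y).
Proof.
move=> hX hY; apply: cvg_probD => //.
by apply: (@cvg_prob_cts _ _ _ P R R -%R Y y _ hY); exact: opp_continuous.
Qed.

Lemma cvg_prob_sqrt X (x : R) : cvg_prob P X x ->
  cvg_prob P (fun n w => Num.sqrt (X n w)) (Num.sqrt x).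
Proof. by apply: cvg_prob_cts; exact: sqrt_continuous. Qed.

Lemma cvg_probV X (x : R) : x != 0 -> cvg_prob P X x ->
  cvg_prob P (fun n w => (X n w)^-1) x^-1.
Proof. by move=> x0; apply: (@cvg_prob_cts _ _ _ P R R (fun z => z^-1));
  exact: inv_continuous. Qed.

End CvgProbAlgebra.

Lemma min_dist_scale (R : realType) (n k : nat) (h : 'cV[R]_n) (nu : R) : 0 < nu ->
  min_dist k h nu = nu ^+ 2 * \sum_(i < n)
    (if (i < n - k)%N then Num.max (`|h i 0| - nu^-1) 0 ^+ 2 else (h i 0 + nu^-1) ^+ 2).
Proof.
move=> nu0; have nun : nu != 0 by rewrite gt_eqF.
rewrite /min_dist big_distrr/=; apply: eq_bigr => i _; case: ifP => _.
  rewrite -exprMn; congr (_ ^+ 2).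
  rewrite normrM (gtr0_norm nu0) maxr_pMr ?(ltW nu0)// mulr0 mulrBr divff//.
by rewrite -exprMn mulrDr divff.
Qed.

Lemma truncn_ratio_le (R : realType) (a : R) n : 0 < a -> a < 1 ->
  (Num.truncn (a * n%:R) <= n)%N.
Proof.
move=> a0 a1; have an0 : 0 <= a * n%:R by rewrite mulr_ge0// ltW.
have /andP[t1 _] := truncn_itv an0.
by rewrite -(ler_nat R) (le_trans t1)// ler_piMl// ltW.
Qed.

(** * Laws of large numbers for g and h *)

Section Gaussian.
Context (R : realType) (d : measure_display) (T : measurableType d).
Variable P : probability T R.

Lemma sqnorm2_g_cvg_prob (alpha : R) (m : nat -> nat)
    (g : forall n : nat, 'I_(m n) -> {RV P >-> R})
    (h : forall n : nat, 'I_n -> {RV P >-> R}) :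
  0 < alpha -> alpha < 1 -> (forall n, m n = Num.truncn (alpha * n%:R)) ->
  (forall n, iid_gaussian_pair (g n) (h n)) ->
  cvg_prob P (fun n w => sqnorm2 (sample (g n) w) / n%:R) alpha.
Proof.
move=> alpha_gt0 alpha_lt1 mE gh_iid.
have [K KP] := @normal_prob01_fourth_lty R 0.
(* The shift by 0 makes the squares an instance, with c = 0, of the moment formulas used for h. *)
have mf : measurable_fun [set: R] (fun x : R => (x + 0) ^+ 2).
  by apply: measurable_funX; exact: measurable_funD.
have mg n i : measurable_fun [set: T] (g n i) by exact: measurable_funPT.
have -> : (fun n w => sqnorm2 (sample (g n) w) / n%:R) =
   (fun n w => (\sum_(i < m n) (fun n (i : 'I_(m n)) w => (g n i w + 0) ^+ 2) n i w) / n%:R).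
  by apply/funext => n; apply/funext => w; congr (_ / _); apply: eq_bigr => i _;
    rewrite mxE addr0.
apply: (@cvg_prob_average _ _ _ P (fun n => 'I_(m n)) _ (fun n i => 1) K).
- by move=> n; rewrite card_ord mE truncn_ratio_le.
- by move=> n i; exact: measurableT_comp mf (mg n i).
- by move=> n i w; exact: sqr_ge0.
- move=> n i; have [ng _ _] := gh_iid n.
  rewrite (standard_normal_integral (ng i) mf) => [|x]; last exact: sqr_ge0.
  by rewrite normal_prob01_shift_sqr expr0n addr0.
- move=> n i; have [ng _ _] := gh_iid n.
  rewrite (@standard_normal_integral _ _ _ _ (g n i) (fun x => ((x + 0) ^+ 2) ^+ 2) (ng
    i)); last 2 first.
  - exact: measurable_funX.
  - by move=> x; exact: sqr_ge0.
  apply: le_trans KP; apply: ge0_le_integral => //.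
  - by move=> x _; rewrite lee_fin sqr_ge0.
  - by apply/measurable_EFinP; exact: measurable_funX.
  - apply/measurable_EFinP; apply: measurable_funX; apply: measurable_funD => //.
    by apply: measurable_funM => //; exact: measurable_funX.
  - move=> x _; have x2 := sqr_ge0 x.
    have x22 : 0 <= 2 * x ^+ 2 by rewrite mulr_ge0.
    by rewrite lee_fin addr0 expr0n/= mulr0 addr0 ler_sqr ?nnegrE//; lra.
- move=> n i j ij; have [ng _ indep] := gh_iid n.
  have ij' : inl i != inl j :> 'I_(m n) + 'I_n by apply: contraNneq ij => -[->].
  have := mutually_independent_integralM indep ij' mf mf (fun x => sqr_ge0 _) (fun x =>
    sqr_ge0 _).
  move=> /= ->; rewrite !(standard_normal_integral (ng _) mf) => [|x|x]; try exact: sqr_ge0.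
  by rewrite normal_prob01_shift_sqr expr0n addr0 mule1 mulr1.
- under eq_fun do rewrite sumr_const card_ord mE.
  exact: truncn_ratio_cvg (ltW alpha_gt0).
Qed.

Lemma min_dist_h_cvg_prob (beta nu : R) (m k : nat -> nat)
    (g : forall n : nat, 'I_(m n) -> {RV P >-> R})
    (h : forall n : nat, 'I_n -> {RV P >-> R}) :
  0 < beta -> beta < 1 -> (forall n, k n = Num.truncn (beta * n%:R)) ->
  (forall n, iid_gaussian_pair (g n) (h n)) -> 0 < nu ->
  cvg_prob P (fun n w => min_dist (k n) (sample (h n) w) nu / n%:R)
    (nu ^+ 2 * psi beta nu^-1).
Proof.
move=> beta_gt0 beta_lt1 kE gh_iid nu0; set c := nu^-1; have c0 : 0 < c by rewrite invr_gt0.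
have [K KP] := @normal_prob01_fourth_lty R c.
pose F n (i : 'I_n) (x : R) := if (i < n - k n)%N then Num.max (`|x| - c) 0 ^+ 2 else (x +
  c) ^+ 2.
have F0 n i x : 0 <= F n i x by rewrite /F; case: ifP => _; exact: sqr_ge0.
have mF n i : measurable_fun [set: R] (F n i).
  rewrite /F; case: (i < n - k n)%N; apply: measurable_funX; last exact: measurable_funD.
  by apply: measurable_maxr => //; apply: measurable_funB => //; exact: normr_measurable.
(* A common majorant for both kinds of coordinates; its square is the integrand of
   [normal_prob01_fourth_lty]. *)
have Fle n i x : F n i x <= 2 * x ^+ 2 + 2 * c ^+ 2.
  have x20 := sqr_ge0 x; have c20 := sqr_ge0 c; have xc := sqr_ge0 (x - c).
  have E : (x + c) ^+ 2 = 2 * x ^+ 2 + 2 * c ^+ 2 - (x - c) ^+ 2 by ring.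
  rewrite /F; case: ifP => _; last by rewrite E; lra.
  apply: (@le_trans _ _ (x ^+ 2)); last lra.
  have [e|e] := leP (`|x| - c) 0; first by rewrite expr0n/=.
  by rewrite -[leRHS]real_normK ?num_real// ler_sqr ?nnegrE ?(ltW e)//; lra.
pose mm n (i : 'I_n) := if (i < n - k n)%N then gauss_excess c else 1 + c ^+ 2.
have mh n i : measurable_fun [set: T] (h n i) by exact: measurable_funPT.
have EF n i : (\int[P]_w (F n i (h n i w))%:E = (mm n i)%:E)%E.
  have [_ nh _] := gh_iid n; rewrite (standard_normal_integral (nh i) (mF n i) (F0 n i)).
  rewrite /F /mm; case: ifP => _; last exact: normal_prob01_shift_sqr.
  exact: normal_prob01_excess_sqr (ltW c0).
have : cvg_prob P (fun n w => nu ^+ 2 * ((\sum_(i < n) F n i (h n i w)) / n%:R)) (nu ^+ 2 *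
  psi beta c).
  apply: cvg_probM; first exact: cvg_prob_cst.
  apply: (@cvg_prob_average _ _ _ P (fun n => 'I_n) (fun n i w => F n i (h n i w)) mm K) => //.
  - by move=> n; rewrite card_ord.
  - by move=> n i; exact: measurableT_comp (mF n i) (mh n i).
  - move=> n i; have [_ nh _] := gh_iid n.
    rewrite (@standard_normal_integral _ _ _ _ (h n i) (fun x => (F n i x) ^+ 2) (nh i));
      last 2 first.
    - exact: measurable_funX.
    - by move=> x; exact: sqr_ge0.
    apply: le_trans KP; apply: ge0_le_integral => //.
    - by move=> x _; rewrite lee_fin sqr_ge0.
    - by apply/measurable_EFinP; apply: measurable_funX; exact: mF.
    - apply/measurable_EFinP; apply: measurable_funX; apply: measurable_funD => //.
      by apply: measurable_funM => //; exact: measurable_funX.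
    - move=> x _; rewrite lee_fin ler_sqr ?nnegrE//.
      exact: le_trans (F0 n i x) (Fle n i x).
  - move=> n i j ij; have [_ nh indep] := gh_iid n.
    have ij' : inr i != inr j :> 'I_(m n) + 'I_n by apply: contraNneq ij => -[->].
    have := mutually_independent_integralM indep ij' (mF n i) (mF n j) (F0 n i) (F0 n j).
    by move=> /= ->; rewrite !EF.
  - have kn n : (k n <= n)%N by rewrite kE truncn_ratio_le.
    have lim : (1 - (k n)%:R / n%:R) * gauss_excess c + ((k n)%:R / n%:R) * (1 + c ^+ 2)
        @[n --> \oo] --> psi beta c.
      have kr : (k n)%:R / n%:R @[n --> \oo] --> beta.
        under eq_fun do rewrite kE.
        exact: truncn_ratio_cvg (ltW beta_gt0).
      apply: cvgD; last by apply: cvgM => //; exact: cvg_cst.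
      by apply: cvgM; [apply: cvgB => //; exact: cvg_cst|exact: cvg_cst].
    apply: cvg_trans lim; apply: near_eq_cvg; near=> n.
    have n0 : n%:R != 0 :> R by rewrite pnatr_eq0 -lt0n; near: n; exists 1%N.
    rewrite /mm sum_ord_if ?leq_subr// subKn// natrB//.
    by field.
move=> hc; apply: cvg_prob_eq hc _; apply: whp_near; apply: nearW => n w.
rewrite min_dist_scale// -mulrA; congr (_ * (_ / _)).
by apply: eq_bigr => i _; rewrite /F mxE.
Unshelve. all: by end_near. Qed.

End Gaussian.

(** * From three points to the solution of the random program *)

Section Main.
Context (R : realType) (d : measure_display) (T : measurableType d).
Variable P : probability T R.
Variables (alpha beta alphaw sigma rsc theta : R).

Lemma concentration_of_program (m k : nat -> nat) (r : nat -> R)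
  (g : forall n : nat, 'I_(m n) -> {RV P >-> R})
  (h : forall n : nat, 'I_n -> {RV P >-> R}) :
  0 < beta -> alpha < 1 -> is_alpha_w beta alphaw -> alphaw < alpha ->
  (forall n, m n = Num.truncn (alpha * n%:R)) ->
  (forall n, k n = Num.truncn (beta * n%:R)) ->
  0 < sigma -> 0 < rsc ->
  r n / Num.sqrt n%:R @[n --> \oo] --> rsc ->
  (forall n, iid_gaussian_pair (g n) (h n)) ->
  is_theta_hat alpha beta sigma rsc theta ->
  let nu := nu_root alpha beta sigma rsc theta in
  let sol n w := gen_solution (k n) sigma (r n) (sample (g n) w) (sample (h n) w) in
  let obj n w := objective sigma (r n) (sample (g n) w) (sample (h n) w) (sol n w) in
  [/\ cvg_prob P (fun n w => (sol n w).1) nu,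
      cvg_prob P (fun n w => obj n w / Num.sqrt n%:R) (limit_value alpha beta sigma rsc nu) &
      whp P (fun n w => feasible (k n) (sample (g n) w) (sample (h n) w) (sol n w) /\
        xi_prim_gen (k n) sigma (r n) (sample (g n) w) (sample (h n) w) = (obj n w)%:E)].
Proof.
move=> beta_gt0 alpha_lt1 alphawP below mE kE sigma_gt0 rsc_gt0 r_lim gh_iid thetaP nu sol obj.
have alpha_gt0 : 0 < alpha by have [? _ _] := alphawP; lra.
have beta_lt1 : beta < 1 by have [? ? _] := alphawP; lra.
have nu0 : 0 < nu := nu_root_gt0 thetaP.
pose S x n w := sqnorm2 (sample (g n) w) * x ^+ 2 - min_dist (k n) (sample (h n) w) x.
pose V x n w := best_value (k n) sigma (r n) (sample (g n) w) (sample (h n) w) x / Num.sqrt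
  n%:R.
have cS x : 0 < x -> cvg_prob P (fun n w => S x n w / n%:R) (limit_radicand alpha beta x).
  move=> x0.
  have hc : cvg_prob P (fun n w => sqnorm2 (sample (g n) w) / n%:R * x ^+ 2 - min_dist (k
    n) (sample (h n) w) x / n%:R)
      (limit_radicand alpha beta x).
    rewrite /limit_radicand mulrBr [_ * alpha]mulrC.
    apply: cvg_probB; last exact: (min_dist_h_cvg_prob beta_gt0 beta_lt1 kE gh_iid x0).
    apply: cvg_probM; last exact: cvg_prob_cst.
    exact: (sqnorm2_g_cvg_prob alpha_gt0 alpha_lt1 mE gh_iid).
  apply: cvg_prob_eq hc _; apply: whp_near; apply: nearW => n w.
  by rewrite /S; ring.
have n_gt0 : \forall n \near \oo, 0 < n%:R :> R by exists 1%N => // n /= n0; rewrite ltr0n.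
have cr : cvg_prob P (fun n w => r n / Num.sqrt n%:R) rsc by exact: cvg_prob_det.
have cV x : 0 < x -> cvg_prob P (V x) (limit_value alpha beta sigma rsc x).
  move=> x0.
  have hc : cvg_prob P (fun n w => sigma * Num.sqrt (S x n w / n%:R) - x * (r n / Num.sqrt
    n%:R))
      (limit_value alpha beta sigma rsc x).
    apply: cvg_probB; last by apply: cvg_probM => //; exact: cvg_prob_cst.
    by apply: cvg_probM; [exact: cvg_prob_cst|apply: cvg_prob_sqrt; exact: cS].
  apply: cvg_prob_eq hc _; apply: whp_near; near=> n => w.
  have n0 : 0 < n%:R :> R by near: n.
  rewrite /V /best_value -/(S x n w) [S x n w / _]mulrC sqrtrM ?invr_ge0 ?(ltW n0)// sqrtrV
    ?(ltW n0)//.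
  by ring.
have [dl dl0 opt] := limit_optimum beta_gt0 alphawP below sigma_gt0 rsc_gt0 thetaP.
have s0 := limit_radicand_gt0 beta_gt0 alphawP below sigma_gt0 rsc_gt0 thetaP.
(* The half-width eps depends on e, since the bound on the optimum costs the gaps between f(nu) and
   f(nu - eps), f(nu + eps), which must be small as well. *)
have good e : 0 < e -> exists eps, [/\ 0 < eps, eps < e &
    whp P (fun n w => [/\ feasible (k n) (sample (g n) w) (sample (h n) w) (sol n w),
      `|(sol n w).1 - nu| < eps,
      `|obj n w / Num.sqrt n%:R - limit_value alpha beta sigma rsc nu| < e &
      xi_prim_gen (k n) sigma (r n) (sample (g n) w) (sample (h n) w) = (obj n w)%:E])].
  (* The upper bound 3 V(nu) - V(nu - eps) - V(nu + eps) carries five random errors and two gaps of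
     the limit value; with e / 8 for each, the total stays below e. *)
  move=> e0; have e80 : 0 < e / 8 by rewrite divr_gt0.
  have near_s : \forall x \near nu, 0 < limit_radicand alpha beta x.
    exact: (@limit_radicand_cvg _ alpha beta nu nu0 [set y | 0 < y] (lt_nbhsr s0)).
  have near_v : \forall x \near nu, `|limit_value alpha beta sigma rsc nu - limit_value
    alpha beta sigma rsc x| < e / 8.
    by move/cvgrPdist_lt: (@limit_value_cvg _ alpha beta sigma rsc nu nu0) => /(_ _ e80).
  have [e1 /= e10 he1] := near_s; have [e2 /= e20 he2] := near_v.
  (* In turn: accuracy e, the range of the strict maximum, positivity of nu - eps, positivity of the
     limit radicand, and small gaps of the limit value. *)
  pose eps := Num.min (Num.min (e / 2) (dl / 2)) (Num.min (nu / 2) (Num.min (e1 / 2) (e2 /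
    2))).
  have half (z : R) : 0 < z -> 0 < z / 2 by lra.
  have eps0 : 0 < eps by rewrite !lt_min !half.
  have [l1 l2 l3 [l4 l5]] : [/\ eps <= e / 2, eps <= dl / 2, eps <= nu / 2 & eps <= e1 / 2
    /\ eps <= e2 / 2].
    by split; [| | |split]; rewrite /eps !ge_min lexx ?orbT.
  have epsn : eps < nu by lra.
  exists eps; split => //; first lra.
  have dm : `|nu - eps - nu| = eps by rewrite addrAC subrr sub0r normrN gtr0_norm.
  have dp : `|nu + eps - nu| = eps by rewrite addrAC subrr add0r gtr0_norm.
  have pm : 0 < nu - eps by lra.
  have pp : 0 < nu + eps by lra.
  have sm : 0 < limit_radicand alpha beta (nu - eps).
    by apply: he1 => /=; rewrite distrC dm; lra.
  have sp : 0 < limit_radicand alpha beta (nu + eps).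
    by apply: he1 => /=; rewrite distrC dp; lra.
  have vm' : `|limit_value alpha beta sigma rsc nu - limit_value alpha beta sigma rsc (nu -
    eps)| < e / 8.
    by apply: he2 => /=; rewrite distrC dm; lra.
  have vp' : `|limit_value alpha beta sigma rsc nu - limit_value alpha beta sigma rsc (nu +
    eps)| < e / 8.
    by apply: he2 => /=; rewrite distrC dp; lra.
  have vm : limit_value alpha beta sigma rsc (nu - eps) < limit_value alpha beta sigma rsc nu.
    apply: opt => //; last by rewrite dm; lra.
    by rewrite -subr_eq0 -normr_eq0 dm gt_eqF.
  have vp : limit_value alpha beta sigma rsc (nu + eps) < limit_value alpha beta sigma rsc nu.
    apply: opt => //; last by rewrite dp; lra.
    by rewrite -subr_eq0 -normr_eq0 dp gt_eqF.
  have gt0 x : 0 < x -> 0 < limit_radicand alpha beta x -> whp P (fun n w => 0 < S x n w /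
    n%:R).
    by move=> x0 sx; exact: cvg_prob_gt (cS x x0) sx.
  have h0 := whpI (gt0 _ nu0 s0) (whpI (gt0 _ pm sm) (gt0 _ pp sp)).
  have h1 := whpI (cvg_prob_gt (cvg_probB (cV _ nu0) (cV _ pm)) (_ : 0 < _)) (cvg_prob_gt
    (cvg_probB (cV _ nu0) (cV _ pp)) (_ : 0 < _)).
  have {}h1 := h1 ltac:(by rewrite subr_gt0) ltac:(by rewrite subr_gt0).
  have h2 := whpI (cvg_prob_dist (cV _ nu0) e80) (whpI (cvg_prob_dist (cV _ pm) e80)
    (cvg_prob_dist (cV _ pp) e80)).
  apply: whp_mono (whpI h0 (whpI h1 h2)) _; near=> n => w.
  have n0 : 0 < n%:R :> R by near: n.
  have q0 : 0 < (Num.sqrt n%:R)^-1 :> R by rewrite invr_gt0 sqrtr_gt0.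
  have i0 : 0 < n%:R^-1 :> R by rewrite invr_gt0.
  move=> [[a0 [am ap]] [[bm bp] [c0 [cm cp]]]].
  move: a0 am ap; rewrite !pmulr_lgt0// => a0 am ap.
  move: (bm) (bp); rewrite /V -!mulrBl !pmulr_lgt0// !subr_gt0 => bm' bp'.
  have [f1 f2 /andP[f3 f4] f5] := gen_solution_localized sigma_gt0 eps0 epsn (ltW a0) (ltW
    am) (ltW ap) bm' bp'.
  split => //.
  have f3' : V nu n w <= obj n w / Num.sqrt n%:R by rewrite /V ler_pM2r.
  have f4' : obj n w / Num.sqrt n%:R <=
      V nu n w + (V nu n w - V (nu - eps) n w) + (V nu n w - V (nu + eps) n w).
    by rewrite /V -!mulrBl -!mulrDl ler_pM2r.
  move: c0 cm cp vm' vp' f3' f4'; rewrite !ltr_norml; set o := obj n w / _.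
  by move=> c0 cm cp vm' vp' f3' f4'; apply/andP; split; lra.
split.
- apply: cvg_probP => e e0; have [eps [_ epse hw]] := good _ e0.
  by apply: whp_mono hw _; apply: nearW => n w [_ + _ _] => /lt_trans; apply.
- apply: cvg_probP => e e0; have [eps [_ _ hw]] := good _ e0.
  by apply: whp_mono hw _; apply: nearW => n w [].
- have [eps [_ _ hw]] := good _ ltr01.
  by apply: whp_mono hw _; apply: nearW => n w [].
Unshelve. all: by end_near. Qed.

End Main.

Theorem corollary1
  (R : realType) (d : measure_display) (T : measurableType d)
  (P : probability T R)
  (alpha beta alphaw sigma rsc theta : R)
  (m k : nat -> nat) (r : nat -> R)
  (g : forall n : nat, 'I_(m n) -> {RV P >-> R})
  (h : forall n : nat, 'I_n -> {RV P >-> R})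
  (beta_gt0 : 0 < beta) (alpha_lt1 : alpha < 1)
  (alphawP : is_alpha_w beta alphaw) (below : alphaw < alpha)
  (mE : forall n, m n = Num.truncn (alpha * n%:R))
  (kE : forall n, k n = Num.truncn (beta * n%:R))
  (sigma_gt0 : 0 < sigma)
  (r_gt0 : forall n, 0 < r n)
  (rsc_gt0 : 0 < rsc)
  (r_lim : r n / Num.sqrt n%:R @[n --> \oo] --> rsc)
  (gh_iid : forall n, iid_gaussian_pair (g n) (h n))
  (thetaP : is_theta_hat alpha beta sigma rsc theta) :
  let Enu := nu_root alpha beta sigma rsc theta in
  let Q := Enu ^+ 2 * Dfun beta theta - 2 * Enu * Cfun beta theta + theta in
  [/\ concentrates_at P
        (fun n w =>
           (nu_gen (k n) sigma (r n) (sample (g n) w) (sample (h n) w))%:E)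
        Enu,
      concentrates_at P
        (fun n w =>
           (norm_w_gen (k n) sigma (r n) (sample (g n) w) (sample (h n) w))%:E)
        (sigma * Num.sqrt (Q / (alpha * Enu ^+ 2 - Q))) &
      concentrates_at P
        (fun n w =>
           (xi_prim_gen (k n) sigma (r n) (sample (g n) w) (sample (h n) w)
            * ((Num.sqrt n%:R)^-1)%:E)%E)
        (sigma * Num.sqrt (alpha * Enu ^+ 2 - Q) - Enu * rsc)].
Proof.
move=> Enu Q.
pose sol n w := gen_solution (k n) sigma (r n) (sample (g n) w) (sample (h n) w).
pose obj n w := objective sigma (r n) (sample (g n) w) (sample (h n) w) (sol n w).
have [c_nu c_obj hw] : [/\ cvg_prob P (fun n w => (sol n w).1) Enu,
      cvg_prob P (fun n w => obj n w / Num.sqrt n%:R) (limit_value alpha beta sigma rsc Enu) &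
      whp P (fun n w => feasible (k n) (sample (g n) w) (sample (h n) w) (sol n w) /\
        xi_prim_gen (k n) sigma (r n) (sample (g n) w) (sample (h n) w) = (obj n w)%:E)].
  exact: (concentration_of_program beta_gt0 alpha_lt1 alphawP below mE kE
    sigma_gt0 rsc_gt0 r_lim gh_iid thetaP).
have alpha_gt0 : 0 < alpha by have [? _ _] := alphawP; lra.
have radE : limit_radicand alpha beta Enu = alpha * Enu ^+ 2 - Q by exact:
  limit_radicand_nu_root.
have s0 : 0 < limit_radicand alpha beta Enu.
  exact: limit_radicand_gt0 alphawP below sigma_gt0 rsc_gt0 thetaP.
rewrite -radE; split.
- apply: concentrates_at_cvg_prob c_nu _.
  by apply: whp_near; apply: nearW.
(* On feasible solutions this is the root of the radicand divided by sqrt n, recovered from the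
   objective as in [norm_w_genE]. *)
- pose y n w := (obj n w / Num.sqrt n%:R + (sol n w).1 * (r n / Num.sqrt n%:R)) / sigma.
  have c_y : cvg_prob P y (Num.sqrt (limit_radicand alpha beta Enu)).
    have -> : Num.sqrt (limit_radicand alpha beta Enu) =
        (limit_value alpha beta sigma rsc Enu + Enu * rsc) / sigma.
      by rewrite /limit_value subrK mulrC mulKf// gt_eqF.
    apply: cvg_probM; last exact: cvg_prob_cst.
    apply: cvg_probD => //; apply: cvg_probM => //; exact: cvg_prob_det.
  have c_w : cvg_prob P (fun n w => sigma * (Num.sqrt (sqnorm2 (sample (g n) w) / n%:R *
    (sol n w).1 ^+ 2 - y n w ^+ 2) / y n w))
      (sigma * Num.sqrt (Q / limit_radicand alpha beta Enu)).
    have -> : Num.sqrt (Q / limit_radicand alpha beta Enu) =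
        Num.sqrt (alpha * Enu ^+ 2 - Num.sqrt (limit_radicand alpha beta Enu) ^+ 2)
        / Num.sqrt (limit_radicand alpha beta Enu).
      rewrite sqr_sqrtr ?(ltW s0)// radE opprB addrCA subrr addr0 -radE.
      by rewrite mulrC sqrtrM ?invr_ge0 ?(ltW s0)// sqrtrV ?(ltW s0)// mulrC.
    apply: cvg_probM; first exact: cvg_prob_cst.
    apply: cvg_probM; last by apply: cvg_probV => //; rewrite gt_eqF// sqrtr_gt0.
    apply: cvg_prob_sqrt; apply: cvg_probB; last by rewrite expr2; apply: cvg_probM.
    apply: cvg_probM; first exact: (sqnorm2_g_cvg_prob alpha_gt0 alpha_lt1 mE gh_iid).
    by rewrite expr2; apply: cvg_probM.
  apply: concentrates_at_cvg_prob c_w _.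
  apply: whp_mono hw _; near=> n => w [fs _].
  have n0 : 0 < n%:R :> R by rewrite ltr0n; near: n; exists 1%N.
  have q0 : 0 < Num.sqrt n%:R :> R by rewrite sqrtr_gt0.
  have q2 : Num.sqrt n%:R ^+ 2 = n%:R :> R by rewrite sqr_sqrtr// ltW.
  rewrite norm_w_genE// -/(sol n w) -/(obj n w); congr (_ * _)%:E.
  (* Residual norm and root of the radicand both scale like sqrt n, so the factor cancels in their
     quotient. *)
  have yE : (obj n w + (sol n w).1 * r n) / sigma = Num.sqrt n%:R * y n w.
    by rewrite /y; field; rewrite !gt_eqF.
  rewrite yE exprMn q2.
  have -> : sqnorm2 (sample (g n) w) * (sol n w).1 ^+ 2 - n%:R * y n w ^+ 2 =
     n%:R * (sqnorm2 (sample (g n) w) / n%:R * (sol n w).1 ^+ 2 - y n w ^+ 2).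
    by field; rewrite gt_eqF.
  rewrite sqrtrM ?(ltW n0)// invfM mulrACA divff ?gt_eqF// mul1r.
  by [].
- apply: concentrates_at_cvg_prob c_obj _.
  by apply: whp_mono hw _; apply: nearW => n w [_ ->]; rewrite EFinM.
Unshelve. all: by end_near. Qed.
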